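(* Let $\mathbf{k}$ be a field, $K$ an algebraic function field of transcendence degree $3$ over $\mathbf{k}$, $\nu$ a rank $1$ $\mathbf{k}$-valuation of $K$ with residue field $\mathbf{k}$, and $R$ a regular local ring with $\mathbf{k}\subset R\subset K$ and fraction field $K$, dominated by $\nu$, with regular parameters $x,y,z$ satisfying $\nu(x)\le\nu(y)\le\nu(z)$. Let $\{P_j\}_{j>0}\cup\{T_j\}_{j>0}$ be the jumping polynomials constructed from this data (construction in the context). For every $\sigma\in S_R=\nu(R\setminus\{0\})$ one has $I_\sigma=\mathcal{A}_\sigma$, where $I_\sigma=\{f\in R\mid \nu(f)\ge\sigma\}$ and $\mathcal{A}_\sigma$ is the ideal of $R$ generated by $\{P^AT^C\mid (A,C)\in\mathcal{N}\times\mathcal{N},\ |(A,C)|\ge\sigma\}$. Thus $\{P_i\}_{i>0}\cup\{T_i\}_{i>0}$ is a generating sequence of $\nu$.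
   Context: **Setting.** $\mathbf{k}$ is a field, $K$ an algebraic function field of transcendence degree $3$ over $\mathbf{k}$, $\nu$ a rank $1$ $\mathbf{k}$-valuation of $K$ with valuation ring $(V,m_V)$, value group $\Gamma\subset\mathbb{R}$ and residue field $V/m_V=\mathbf{k}$; $\nu(0)=\infty$. $(R,m_R)$ is a regular local ring with $\mathbf{k}\subset R\subset K$, fraction field $K$, dominated by $\nu$ ($R\subset V$, $R\cap m_V=m_R$), with regular parameters $x,y,z$ and $\nu(x)\le\nu(y)\le\nu(z)$. **Notation.** $\mathbb{N}$ is the set of positive integers, $\mathbb{N}_0$ of nonnegative integers. $\mathcal{N}=\bigcup_{n\ge1}\mathbb{N}_0^n$ is the set of sequences of nonnegative integers with finitely many nonzero terms (vectors in $\mathbb{N}_0^n$ are padded with zeros). $E_n$ is the vector with $n$-th entry $1$ and all others $0$; $\bar 0$ is the zero vector. $A\preceq B$ means $a_i\le b_i$ for all $i$; $A\prec B$ means $A\preceq B$ and $A\ne B$. For $(A,C)\in\mathbb{N}_0^n\times\mathbb{N}_0^m$, $AC\in\mathbb{N}_0^{n+m}$ is the concatenation. For a sequence of nonnegative reals $\alpha_1,\alpha_2,\dots$: $\alpha(n)=(\alpha_1,\dots,\alpha_n)$, $A\cdot\alpha(n)=\sum_{i\le n}a_i\alpha_i$, $\langle\alpha(n)\rangle=\sum_{i\le n}\alpha_i\mathbb{Z}$, $[\alpha(n)]=\sum_{i\le n}\alpha_i\mathbb{N}_0$. A real $\sigma$ is commensurable with a subgroup $G\subseteq\mathbb{R}$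 if $s\sigma\in G$ for some $s\in\mathbb{N}$; it is commensurable with $\alpha(n)$ if it is so with $\langle\alpha(n)\rangle$. $A\in\mathcal{N}$ pushes $\alpha_{n+1}$ into $[\alpha(n)]$ if $a_{n+1}>0$ and $A\cdot\alpha(n+1)\in[\alpha(n)]$; if $\alpha_{n+1}$ is commensurable with $\alpha(n)$, $A$ is reduced with respect to $\alpha(n+1)$ if it pushes $\alpha_{n+1}$ into $[\alpha(n)]$ and no $B\prec A$ does. For $\mathcal{S}\subseteq\mathcal{N}\times\mathcal{N}$, $(A,C)$ is irreducible with respect to $\mathcal{S}$ if $(B,D)\notin\mathcal{S}$ for all $B\preceq A$, $D\preceq C$. $P^A=\prod_iP_i^{a_i}$, $T^C=\prod_iT_i^{c_i}$. **Construction of the $P_j$.** $P_1=x$, $P_2=y$, $\mathcal{P}_1=\mathcal{P}_2=\emptyset$; $\beta_i=\nu(P_i)$, $G_i=\langle\beta(i)\rangle$, $S_i=[\beta(i)]$. For $i>1$: if $\beta_i$ is commensurable with $\beta(i-1)$, let $q_i=\min\{q\in\mathbb{N}\mid q\beta_i\in G_{i-1}\}$, let $L(i)\in\mathbb{N}_0^{i-1}$ be such that $(L(i),\bar0)$ is irreducible with respect to $\mathcal{P}_i$ and $q_i\beta_i=L(i)\cdot\beta(i-1)$, let $\lambda_i\in\mathbf{k}$ be the residue of $P_i^{q_i}/P^{L(i)}$ in $V/m_V$, and set $P_{i+1}=P_i^{q_i}-\lambda_iP^{L(i)}$, $\mathcal{P}_{i+1}=\mathcal{P}_i\cup\{(q_iE_i,\bar0)\}$.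 Otherwise $q_i=\infty$ and $P_i$ is the last element of the sequence. Set $G_0=\{0\}$, $q_1=\infty$, $G=\bigcup_jG_j$, $S=\bigcup_jS_j$, $\mathcal{P}=\bigcup_j\mathcal{P}_j$. **Construction of the $T_j$.** $T_1=z$, $m_0=1$, $\delta_0=1$, $\mathcal{T}_1=\mathcal{P}$, $H_0=\{0\}$, $U_0=\{0\}$; $\gamma_i=\nu(T_i)$ if $T_i\ne0$ and $\gamma_i=0$ if $T_i=0$; $H_i=\langle\gamma(i)\rangle$, $U_i=[\gamma(i)]$. For coefficient vectors, $|(A,C)|=A\cdot\beta+C\cdot\gamma=\sum_ja_j\beta_j+\sum_tc_t\gamma_t$. For $i\ge1$: (1) if $T_i\ne0$ and $\gamma_i$ is commensurable with $G+H_{i-1}$, set $s_i=\min\{s\in\mathbb{N}\mid s\gamma_i\in G+H_{i-1}\}$, $m_i=\max(m_{i-1},\min\{j\in\mathbb{N}\mid s_i\gamma_i\in G_j+H_{i-1}\})$, $\mathcal{D}_i=\{(A,C)\in\mathbb{N}_0^{m_i}\times\mathbb{N}_0^i\mid (A,C)$ is irreducible with respect to $\mathcal{T}_i$ and $AC$ is reduced with respect to $(\beta_1,\dots,\beta_{m_i},\gamma_1,\dots,\gamma_i)\}$, $\mathcal{T}_{i+1}=\mathcal{T}_i\cup\mathcal{D}_i$, $\delta_i=\#\mathcal{D}_i$. Order $\mathcal{D}_i=\{(A,C)_1,\dots,(A,C)_{\delta_i}\}$ with $|(A,C)_1|\le\dots\le|(A,C)_{\delta_i}|$. For $(A,C)=(A,C)_k$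 let $L(AC)\in\mathbb{N}_0^{m_i}$, $N(AC)\in\mathbb{N}_0^{i-1}$ be such that $(L(AC),N(AC))$ is irreducible with respect to $\mathcal{T}_i$ and $|(A,C)|=|(L(AC),N(AC))|$, let $\mu_{AC}\in\mathbf{k}$ be the residue of $P^AT^C/P^{L(AC)}T^{N(AC)}$ in $V/m_V$, and set $T_{(\sum_{j=0}^{i-1}\delta_j)+k}=T_{AC}=P^AT^C-\mu_{AC}P^{L(AC)}T^{N(AC)}$. (2) If $T_i\neq 0$ and $\gamma_i$ is not commensurable with $G+H_{i-1}$: $s_i=\infty$, $m_i=m_{i-1}$, $\mathcal{D}_i=\emptyset$, $\delta_i=0$, $\mathcal{T}_{i+1}=\mathcal{T}_i$. (3) If $T_i=0$: $s_i=1$, $m_i=m_{i-1}$, $\mathcal{D}_i=\emptyset$, $\delta_i=0$, $\mathcal{T}_{i+1}=\mathcal{T}_i\cup\{(\bar0,E_i)\}$. Set $\mathcal{T}=\bigcup_i\mathcal{T}_i$. All required vectors exist and are unique and every $\mathcal{D}_i$ is finite, so the construction is well defined. Either sequence may be finite; indices range only over values for which the objects are defined. **Generating sequence.** A collection $\{Q_i\}_{i\in I}$ of elements of $R$ is a generating sequence of $\nu$ if for every $\sigma\in S_R$ the ideal $I_\sigma$ is generated by the set of all finite products $Q^B=\prod_iQ_i^{b_i}$ (with $b_i\in\mathbb{N}_0$, finitely many nonzero) with $\nu(Q^B)\ge\sigma$. *)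

(* Defs.v *)
From HB Require Import structures.
From mathcomp Require Import all_boot all_order all_algebra finmap.
From mathcomp Require Import boolp classical_sets reals constructive_ereal.
From mathcomp Require Import(canonicals) mpoly.
Set Implicit Arguments.
Unset Strict Implicit.
Unset Printing Implicit Defensive.

Import Order.TTheory GRing.Theory Num.Theory.
Local Open Scope classical_set_scope.
Local Open Scope ring_scope.

(* All sequences are indexed from 0: P i, T i, beta i, gamma i stand for the   *)
(* usual P_(i+1), T_(i+1), beta_(i+1), gamma_(i+1).  The objects attached to   *)
(* "the first n terms" of a sequence (spans, dimensions) keep their index n.   *)

(** * Commutative algebra *)

Section CommutativeAlgebra.
Variable R : comNzRingType.

Definition ideal (I : set R) : Prop :=
  [/\ I 0, forall a b, I a -> I b -> I (a + b) & forall r a, I a -> I (r * a)].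

Definition ideal_gen (G : set R) : set R := smallest ideal G.

Definition noetherian : Prop :=
  forall I : set R, ideal I -> exists s : seq R, I = ideal_gen [set` s].

Definition prime_ideal (p : set R) : Prop :=
  [/\ ideal p, ~ p 1 & forall a b, p (a * b) -> p a \/ p b].

Definition maximal_ideal (m : set R) : Prop :=
  [/\ ideal m, ~ m 1 &
      forall I : set R, ideal I -> ~ I 1 -> m `<=` I -> I = m].

Definition local_ring (m : set R) : Prop :=
  maximal_ideal m /\ forall m', maximal_ideal m' -> m' = m.

Definition prime_chain (d : nat) (p : nat -> set R) : Prop :=
  (forall i, (i <= d)%N -> prime_ideal (p i)) /\
  (forall i, (i < d)%N -> p i `<` p i.+1).

Definition krull_dim (d : nat) : Prop :=
  (exists p, prime_chain d p) /\ ~ (exists p, prime_chain d.+1 p).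

Definition regular_local_ring (m : set R) (d : nat) : Prop :=
  [/\ noetherian, local_ring m, krull_dim d &
      exists s : d.-tuple R, m = ideal_gen [set` s]].

(* A system of three regular parameters, when R is regular of dimension 3. *)
Definition regular_parameters3 (m : set R) (x y z : R) : Prop :=
  m = ideal_gen [set` [:: x; y; z]].

End CommutativeAlgebra.

(** * Algebraic function fields *)

Section FunctionField.
Variables (k K : fieldType) (iK : {rmorphism k -> K}).

Definition subfield (F : set K) : Prop :=
  [/\ F 1, forall a b, F a -> F b -> F (a - b) &
      forall a b, F a -> F b -> F (a / b)].

(* k(S) *)
Definition field_gen (S : set K) : set K := smallest subfield (range iK `|` S).

Definition algebraic_over (F : set K) (f : K) : Prop :=
  exists p : {poly K}, [/\ p != 0, forall i, F p`_i & root p f].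

Definition algebraically_independent (d : nat) (t : 'I_d -> K) : Prop :=
  forall p : mpoly.mpoly d k, mpoly.mmap iK t p = 0 -> p = 0.

Definition transcendence_degree (d : nat) : Prop :=
  exists t : 'I_d -> K, algebraically_independent t /\
    forall f, algebraic_over (field_gen (range t)) f.

Definition function_field (d : nat) : Prop :=
  (exists s : seq K, field_gen [set` s] = setT) /\ transcendence_degree d.

End FunctionField.

(** * Valuations *)

Section Valuation.
Variables (RR : realType) (k K : fieldType) (iK : {rmorphism k -> K}).
Variable nu : K -> \bar RR.

(* Rank 1 means that the value group is a nonzero subgroup of the reals. *)
Record rank1_valuation : Prop := {
  val0 : nu 0 = +oo%E ;
  val_fin : forall f, f != 0 -> nu f \is a fin_num ;
  valM : forall f g, nu (f * g) = (nu f + nu g)%E ;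
  valD : forall f g, (Order.min (nu f) (nu g) <= nu (f + g))%E ;
  val_trivial_on_k : forall c : k, c != 0 -> nu (iK c) = 0%E ;
  val_nontrivial : exists2 f, f != 0 & nu f != 0%E }.

(* c is the residue of f in V/m_V, where k is identified with its image. *)
Definition is_residue (f : K) (c : k) : Prop :=
  (0 <= nu f)%E /\ (0 < nu (f - iK c))%E.

Definition residue_field_is_k : Prop :=
  forall f, (0 <= nu f)%E -> exists c, is_residue f c.

End Valuation.

Section Dominated.
Variables (RR : realType) (K : fieldType) (nu : K -> \bar RR).
Variables (R : comNzRingType) (j : {rmorphism R -> K}).

Definition dominated_by (m : set R) : Prop :=
  (forall a, (0 <= nu (j a))%E) /\ (forall a, m a <-> (0 < nu (j a))%E).

Definition is_fraction_field : Prop :=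
  injective j /\ forall f : K, exists a b : R, b != 0 /\ f = j a / j b.

(* S_R = nu(R \ {0}) *)
Definition value_semigroup : set RR :=
  [set s | exists2 a : R, a != 0 & nu (j a) = s%:E].

Definition valuation_ideal (s : RR) : set R := [set f | (s%:E <= nu (j f))%E].

End Dominated.

(** * Vectors of nonnegative integers *)

Notation vec := {fsfun nat -> nat with 0%N}.

Section Vectors.
Implicit Types A B C : vec.

Definition in_dim (n : nat) A : Prop := forall i, (n <= i)%N -> A i = 0%N.

Definition vzero : vec := [fsfun].

(* q E_(i+1) *)
Definition vsingle (q i : nat) : vec := [fsfun [fsfun] with i |-> q].

Definition vle A B : Prop := forall i, (A i <= B i)%N.
Definition vlt A B : Prop := vle A B /\ A <> B.

(* The concatenation AC, for A of dimension m. *)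
Definition vcat (m : nat) A C : vec :=
  [fsfun i in ([fset i in iota 0 m] `|` [fset (m + i)%N | i in finsupp C])%fset
     => if (i < m)%N then A i else C (i - m)%N].

Definition irreducible_wrt (S : set (vec * vec)) (AC : vec * vec) : Prop :=
  forall B D, vle B AC.1 -> vle D AC.2 -> ~ S (B, D).

End Vectors.

Section Spans.
Variable RR : realType.
Implicit Types (al be ga : nat -> RR) (A C : vec) (G H : set RR).

(* <alpha(n)> and [alpha(n)] *)
Definition gspan al n : set RR :=
  [set r | exists a : 'I_n -> int, r = \sum_(i < n) al i *~ a i].
Definition sspan al n : set RR :=
  [set r | exists a : 'I_n -> nat, r = \sum_(i < n) al i *+ a i].

Definition setD2 G H : set RR := [set g + h | g in G & h in H].

Definition commensurable (r : RR) G : Prop :=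
  exists2 s : nat, (0 < s)%N & G (r *+ s).

(* A . alpha(n) *)
Definition dotn al n A : RR := \sum_(i < n) al i *+ A i.

Definition weight be ga (AC : vec * vec) : RR :=
  \sum_(i <- finsupp AC.1) be i *+ AC.1 i +
  \sum_(i <- finsupp AC.2) ga i *+ AC.2 i.

(* A pushes alpha_(n+1) into [alpha(n)]. *)
Definition pushes al n A : Prop :=
  (0 < A n)%N /\ sspan al n (dotn al n.+1 A).

(* A is reduced with respect to alpha(n+1). *)
Definition reduced al n A : Prop :=
  [/\ commensurable (al n) (gspan al n), pushes al n A &
      forall B, vlt B A -> ~ pushes al n B].

(* (alpha_1, ..., alpha_m, gamma_1, gamma_2, ...) *)
Definition scat m al ga : nat -> RR :=
  fun i => if (i < m)%N then al i else ga (i - m)%N.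

End Spans.

(* The least element of a nonempty set of natural numbers. *)
Definition least (S : set nat) : nat :=
  xget 0%N [set n | S n /\ forall n', S n' -> (n <= n')%N].

Definition monomial (R : comNzRingType) (Q : nat -> R) (A : vec) : R :=
  \prod_(i <- finsupp A) Q i ^+ A i.

(** * Jumping polynomials *)

Section JumpingPolynomials.
Variables (RR : realType) (k K : fieldType) (R : comNzRingType).
Variables (iK : {rmorphism k -> K}) (iR : {rmorphism k -> R}).
Variables (j : {rmorphism R -> K}) (nu : K -> \bar RR).

(* P and T are total functions, meaningful only on the indices i such that    *)
(* definedP i, resp. definedT i: either sequence may be finite.  D i is the    *)
(* ordered list of the elements of the set D_(i+1).                            *)
Variables (P T : nat -> R) (D : nat -> seq (vec * vec)).

Definition beta (i : nat) : RR := fine (nu (j (P i))).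

Definition P_commensurable (i : nat) : Prop :=
  commensurable (beta i) (gspan beta i).

(* The sequence stops at the first i > 0 which is not commensurable. *)
Definition definedP (i : nat) : Prop :=
  forall i', (0 < i' < i)%N -> P_commensurable i'.

Definition qP (i : nat) : nat :=
  least [set q | (0 < q)%N /\ gspan beta i (beta i *+ q)].

(* Script P_(i+1). *)
Definition calPn (i : nat) : set (vec * vec) :=
  [set AC | exists2 i', (0 < i' < i)%N & AC = (vsingle (qP i') i', vzero)].

Definition calP : set (vec * vec) :=
  [set AC | exists2 i, definedP i & calPn i AC].

Definition G_all : set RR :=
  [set r | exists2 i, definedP i & gspan beta i.+1 r].

(* For T i = 0 this is fine +oo = 0, which is the convention for gamma. *)
Definition gamma (i : nat) : RR := fine (nu (j (T i))).

Definition T_commensurable (i : nat) : Prop :=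
  T i <> 0 /\ commensurable (gamma i) (setD2 G_all (gspan gamma i)).

Definition sT (i : nat) : nat :=
  least [set s | (0 < s)%N /\ setD2 G_all (gspan gamma i) (gamma i *+ s)].

(* mT 0 = m_0, and mT i.+1 = m_(i+1) is computed from T i = T_(i+1). *)
Fixpoint mT (i : nat) : nat :=
  if i is i'.+1 then
    if `[< T_commensurable i' >] then
      maxn (mT i') (least [set n | [/\ (0 < n)%N, definedP n.-1 &
        setD2 (gspan beta n) (gspan gamma i') (gamma i' *+ sT i')]])
    else mT i'
  else 1%N.

(* Script D_(i+1), relative to S = script T_(i+1). *)
Definition calD_of (S : set (vec * vec)) (i : nat) : set (vec * vec) :=
  [set AC | [/\ in_dim (mT i.+1) AC.1, in_dim i.+1 AC.2, irreducible_wrt S AC &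
    reduced (scat (mT i.+1) beta gamma) (mT i.+1 + i)%N
      (vcat (mT i.+1) AC.1 AC.2)]].

(* Script T_(i+1). *)
Fixpoint calT (i : nat) : set (vec * vec) :=
  if i is i'.+1 then
    calT i' `|` [set AC | (T_commensurable i' /\ calD_of (calT i') i' AC)
                          \/ (T i' = 0 /\ AC = (vzero, vsingle 1 i'))]
  else calP.

Definition calD (i : nat) : set (vec * vec) := calD_of (calT i) i.

(* The index of the first of the polynomials T_AC produced by D i. *)
Definition T_offset (i : nat) : nat := (1 + \sum_(i' < i) size (D i'))%N.

(* T i is either T 0 or produced by D i' for some earlier i' < i. *)
Definition definedT (i : nat) : Prop := (i < T_offset i)%N.

Definition P_step (i : nat) : Prop :=
  exists (L : vec) (lam : k),
    [/\ in_dim i L,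
        irreducible_wrt (calPn i) (L, vzero),
        beta i *+ qP i = dotn beta i L,
        is_residue iK nu (j (P i ^+ qP i) / j (monomial P L)) lam &
        P i.+1 = P i ^+ qP i - iR lam * monomial P L].

Definition T_step (i n : nat) (AC : vec * vec) : Prop :=
  exists (L N : vec) (mu : k),
    [/\ in_dim (mT i.+1) L /\ in_dim i N,
        irreducible_wrt (calT i) (L, N),
        weight beta gamma AC = weight beta gamma (L, N),
        is_residue iK nu (j (monomial P AC.1 * monomial T AC.2) /
                          j (monomial P L * monomial T N)) mu &
        T n = monomial P AC.1 * monomial T AC.2
              - iR mu * (monomial P L * monomial T N)].

Record jumping_polynomials (x y z : R) : Prop := {
  jp_P0 : P 0 = x ;
  jp_P1 : P 1 = y ;
  jp_Pstep : forall i, (0 < i)%N -> definedP i -> P_commensurable i ->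
    P_step i ;
  jp_T0 : T 0 = z ;
  jp_D : forall i, definedT i -> T_commensurable i ->
    [/\ uniq (D i),
        forall AC, AC \in D i <-> calD i AC &
        sorted (fun AC AC' => weight beta gamma AC <= weight beta gamma AC')
               (D i)] ;
  jp_Dnil : forall i, ~ (definedT i /\ T_commensurable i) -> D i = [::] ;
  jp_Tstep : forall i n, definedT i -> (n < size (D i))%N ->
    T_step i (T_offset i + n) (nth (vzero, vzero) (D i) n) }.

(* The vectors (A,C) such that P^A T^C only involves existing P_j and T_j. *)
Definition exponents : set (vec * vec) :=
  [set AC | (forall i, i \in finsupp AC.1 -> definedP i) /\
            (forall i, i \in finsupp AC.2 -> definedT i)].

(* A_sigma *)
Definition monomial_ideal (s : RR) : set R :=
  ideal_gen [set f | exists AC : vec * vec,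
    [/\ exponents AC, s <= weight beta gamma AC &
        f = monomial P AC.1 * monomial T AC.2]].

(* {P_j} U {T_j}, as a family indexed by jumping_index. *)
Definition jumping_index : set (nat + nat) :=
  [set i | match i with inl a => definedP a | inr b => definedT b end].
Definition jumping_family (i : nat + nat) : R :=
  match i with inl a => P a | inr b => T b end.

End JumpingPolynomials.

Section GeneratingSequence.
Variables (RR : realType) (K : fieldType) (R : comNzRingType).
Variables (j : {rmorphism R -> K}) (nu : K -> \bar RR).

Definition generating_sequence (I : choiceType) (E : set I) (Q : I -> R) :=
  forall s : RR, value_semigroup nu j s ->
    valuation_ideal nu j s =
    ideal_gen [set f | exists B : {fsfun I -> nat with 0%N},
      [/\ forall i, i \in finsupp B -> E i,
          f = \prod_(i <- finsupp B) Q i ^+ B i &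
          (s%:E <= nu (j f))%E]].

End GeneratingSequence.

(* Main.v *)
(** Idea: by the relations defining the P_j and T_j, every monomial P^A T^C is,
    up to a constant of k and modulo monomials of larger value, the unique
    irreducible monomial of the same weight.  Hence each graded piece of the
    filtration of R by the ideals A_t spanned by monomials of value > t is at
    most one-dimensional over k, generated by a monomial whose value is its
    degree.  Since R is spanned over k by finitely many elements modulo a high
    power of m, only finitely many values lie below sigma, and an element of
    value at least sigma descends through the filtration, from A_(-1) = R, to
    the ideal of monomials of value at least sigma. *)
Require Import Defs.
From HB Require Import structures.
From mathcomp Require Import all_boot all_order all_algebra finmap zify ring lra.
From mathcomp Require Import boolp classical_sets reals constructive_ereal.
Set Implicit Arguments.
Unset Strict Implicit.
Unset Printing Implicit Defensive.

Import Order.TTheory GRing.Theory Num.Theory.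
Local Open Scope classical_set_scope.
Local Open Scope ring_scope.

(** * Exponent vectors *)

(** Uniqueness of the irreducible monomial of a given weight is arithmetic in the value groups. Two
    irreducible [P]-exponents are compared at the last entry where they differ: the difference times
    the corresponding value lies in the span of the preceding values, against the minimality of [qP]
    (or, at entry 0, against [0 < beta 0]). For the [T] such a difference exposes an element of
    [calD]. The obstacle is that [calD] sees only the first [mT] entries of a [P]-exponent, so
    agreement of the later entries needs its own argument. Reduction terminates because each
    relation lowers the exponent of the last variable treated, and its error term is again a
    monomial, namely the next jumping polynomial. Coefficients of ideal elements lie in R and not in
    k; they are replaced by their residues, the error falling into m, which is generated by the
    monomials x, y, z. Some [P i] or [T i] may vanish: the value is then infinite while [beta] or
    [gamma] is 0. Hence the ideals are cut out by values, which agree with weights on nonzero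
    monomials only. *)

Section FinitelySupported.
Variable I : choiceType.
Implicit Types (A B : {fsfun I -> nat with 0%N}) (i : I).

(** The index type is arbitrary because exponents over [nat + nat] occur at the end, besides those
    over [nat]. *)
Definition fsadd A B : {fsfun I -> nat with 0%N} :=
  [fsfun i in (finsupp A `|` finsupp B)%fset => (A i + B i)%N].

Definition fssub A B : {fsfun I -> nat with 0%N} :=
  [fsfun i in finsupp A => (A i - B i)%N].

Lemma fsaddE A B i : fsadd A B i = (A i + B i)%N.
Proof.
rewrite fsfunE inE !mem_finsupp; case: eqP => // ->.
by case: eqP => // ->.
Qed.

Lemma fssubE A B i : fssub A B i = (A i - B i)%N.
Proof. by rewrite fsfunE mem_finsupp; case: eqP => // ->. Qed.

(** Indices outside the support contribute neutral terms. [F] takes the exponent as an argument so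
    that weights and monomials are both instances. *)
Lemma big_finsupp (V : Type) (idx : V) (op : Monoid.com_law idx) A
    (s : seq I) (F : I -> nat -> V) :
  uniq s -> (forall i, F i 0%N = idx) -> {subset finsupp A <= s} ->
  \big[op/idx]_(i <- s) F i (A i) = \big[op/idx]_(i <- finsupp A) F i (A i).
Proof.
move=> us F0 sub; rewrite (bigID (mem (finsupp A))) /=.
rewrite [X in op _ X]big1 ?Monoid.mulm1; last first.
  by move=> i; rewrite memNfinsupp => /eqP ->.
rewrite -big_filter; apply: perm_big; apply: uniq_perm => //.
- exact: filter_uniq.
- move=> i; rewrite mem_filter /=; case: (boolP (i \in _)) => //= ia.
  by rewrite (sub _ ia).
Qed.

Lemma big_fsadd (V : Type) (idx : V) (op : Monoid.com_law idx) A B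
    (F : I -> nat -> V) :
  (forall i, F i 0%N = idx) -> (forall i m n, F i (m + n)%N = op (F i m) (F i n)) ->
  \big[op/idx]_(i <- finsupp (fsadd A B)) F i (fsadd A B i) =
  op (\big[op/idx]_(i <- finsupp A) F i (A i))
     (\big[op/idx]_(i <- finsupp B) F i (B i)).
Proof.
move=> F0 FD; pose s : {fset I} := (finsupp A `|` finsupp B)%fset.
rewrite -!(@big_finsupp _ _ op _ s) ?fset_uniq //.
- by rewrite -big_split; apply: eq_bigr => i _; rewrite fsaddE FD.
- by move=> i ib; rewrite inE ib orbT.
- by move=> i ia; rewrite inE ia.
- move=> i; rewrite inE !mem_finsupp fsaddE.
  by case: (A i) => // ? ; rewrite addSn.
Qed.

Lemma fsaddC A B : fsadd A B = fsadd B A.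
Proof. by apply/fsfunP => i; rewrite !fsaddE addnC. Qed.

Lemma fsadd_sub A B : (forall i, (B i <= A i)%N) -> fsadd B (fssub A B) = A.
Proof. by move=> h; apply/fsfunP => i; rewrite fsaddE fssubE subnKC. Qed.

End FinitelySupported.

Section Vec.
Implicit Types (A B C : vec).

(** Applied to a vector, this is its truncation to the first [n] entries. *)
Definition mkvec n (f : nat -> nat) : vec :=
  [fsfun i in [fset i in iota 0 n]%fset => f i].

Lemma mkvecE n f i : mkvec n f i = if (i < n)%N then f i else 0%N.
Proof. by rewrite fsfunE !inE mem_iota. Qed.

Lemma vzeroE i : vzero i = 0%N.
Proof. by rewrite fsfun_dflt // finsupp0 inE. Qed.

Lemma vsingleE q i i' : vsingle q i i' = if i' == i then q else 0%N.
Proof. by rewrite /vsingle fsfun_withE vzeroE. Qed.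

Lemma vcatE m A C i : vcat m A C i = if (i < m)%N then A i else C (i - m)%N.
Proof.
rewrite fsfunE !inE mem_iota /= add0n; case: ltnP => //= le_mi.
case: imfsetP => [//|nex]; have [//|ne] := eqVneq (C (i - m)%N) 0%N.
by case: nex; exists (i - m)%N; rewrite /= ?mem_finsupp // subnKC.
Qed.

Lemma in_dim_mkvec n f : in_dim n (mkvec n f).
Proof. by move=> i; rewrite mkvecE ltnNge => ->. Qed.

Lemma in_dim_vzero n : in_dim n vzero.
Proof. by move=> i _; rewrite vzeroE. Qed.

Lemma in_dimW m n A : (m <= n)%N -> in_dim m A -> in_dim n A.
Proof. by move=> mn h i ni; rewrite h // (leq_trans mn). Qed.

Lemma in_dim_fsadd n A B : in_dim n A -> in_dim n B -> in_dim n (fsadd A B).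
Proof. by move=> a b i ni; rewrite fsaddE a // b. Qed.

Lemma in_dim_ex A : exists n, in_dim n A.
Proof.
exists (\max_(i <- finsupp A) i).+1 => i; rewrite ltnNge => /negP h.
apply/eqP; rewrite -memNfinsupp; apply/negP => ia; apply: h.
by rewrite (big_rem _ ia) /= leq_maxl.
Qed.

Lemma vec_split n A : in_dim n.+1 A ->
  A = fsadd (mkvec n A) (vsingle (A n) n).
Proof.
move=> h; apply/fsfunP => i; rewrite fsaddE mkvecE vsingleE.
case: ltngtP => [lt_in|lt_ni|->]; rewrite ?addn0 // h //.
Qed.

Lemma mkvec_id n A : in_dim n A -> mkvec n A = A.
Proof.
by move=> h; apply/fsfunP => i; rewrite mkvecE; case: ltnP => // /h.
Qed.

End Vec.

Section Weights.
Variable V : zmodType.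
Implicit Types (al : nat -> V) (A B : vec).

Definition wt al A : V := \sum_(i <- finsupp A) al i *+ A i.

Lemma wtD al A B : wt al (fsadd A B) = wt al A + wt al B.
Proof.
apply: (@big_fsadd _ _ _ _ A B (fun i n => al i *+ n)) => //.
by move=> i m n; rewrite mulrnDr.
Qed.

Lemma wt_sum al n A : in_dim n A -> wt al A = \sum_(i < n) al i *+ A i.
Proof.
move=> h; rewrite -(big_mkord xpredT (fun i => al i *+ A i)) /index_iota subn0.
symmetry; apply: (@big_finsupp _ _ _ _ A _ (fun i n => al i *+ n)).
- exact: iota_uniq.
- by [].
move=> i; rewrite mem_finsupp mem_iota /= add0n ltnNge; apply: contra => /h.
by move=> ->.
Qed.

Lemma wt_vzero al : wt al vzero = 0.
Proof. by rewrite (wt_sum _ (@in_dim_vzero 0)) big_ord0. Qed.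

Lemma wt_vsingle al q i : wt al (vsingle q i) = al i *+ q.
Proof.
rewrite (@wt_sum _ i.+1) => [|t it]; last first.
  by rewrite vsingleE; case: eqP it => // ->; rewrite ltnn.
rewrite big_ord_recr /= vsingleE eqxx big1 ?add0r // => t _.
by rewrite vsingleE ltn_eqF // mulr0n.
Qed.

(** The common tail from entry [n] on has the same weight on both sides and cancels. *)
Lemma wt_agree al n A B : (forall i, (n <= i)%N -> A i = B i) ->
  wt al A - wt al B = wt al (mkvec n A) - wt al (mkvec n B).
Proof.
move=> agree.
have tailE : fssub A (mkvec n A) = fssub B (mkvec n B).
  apply/fsfunP => i; rewrite !fssubE !mkvecE.
  by case: ltnP => [_|/agree ->]; rewrite ?subnn.
have split (X : vec) : wt al X = wt al (mkvec n X) + wt al (fssub X (mkvec n X)).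
  by rewrite -wtD fsadd_sub // => i; rewrite mkvecE; case: ifP.
by rewrite (split A) (split B) tailE opprD addrACA subrr addr0.
Qed.

Lemma wt_mkvecS al n A : wt al (mkvec n.+1 A) = wt al (mkvec n A) + al n *+ A n.
Proof.
rewrite (vec_split (@in_dim_mkvec n.+1 A)) wtD wt_vsingle mkvecE ltnSn.
congr (wt al _ + _); apply/fsfunP => i; rewrite !mkvecE; case: ltnP => // lt.
by rewrite ltnW.
Qed.

End Weights.

Section Monomials.
Variables (R : comNzRingType) (Q : nat -> R).

Lemma monomialD A B :
  monomial Q (fsadd A B) = monomial Q A * monomial Q B.
Proof.
apply: (@big_fsadd _ _ _ _ A B (fun i n => Q i ^+ n)) => //.
by move=> i m n; rewrite exprD.
Qed.

Lemma monomial_prod n A : in_dim n A -> monomial Q A = \prod_(i < n) Q i ^+ A i.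
Proof.
move=> h; rewrite -(big_mkord xpredT (fun i => Q i ^+ A i)) /index_iota subn0.
symmetry; apply: (@big_finsupp _ _ _ _ A _ (fun i n => Q i ^+ n)).
- exact: iota_uniq.
- by [].
move=> i; rewrite mem_finsupp mem_iota /= add0n ltnNge; apply: contra => /h.
by move=> ->.
Qed.

Lemma monomial_vzero : monomial Q vzero = 1.
Proof. by rewrite (monomial_prod (@in_dim_vzero 0)) big_ord0. Qed.

Lemma monomial_vsingle q i : monomial Q (vsingle q i) = Q i ^+ q.
Proof.
rewrite (@monomial_prod i.+1) => [|t it]; last first.
  by rewrite vsingleE; case: eqP it => // ->; rewrite ltnn.
rewrite big_ord_recr /= vsingleE eqxx big1 ?mul1r // => t _.
by rewrite vsingleE ltn_eqF.
Qed.

End Monomials.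
(** * Spans and value groups *)

Lemma leastP (S : set nat) : (exists n, S n) ->
  S (least S) /\ forall n, S n -> (least S <= n)%N.
Proof.
move=> exS; have exb : exists n, `[< S n >].
  by case: exS => n Sn; exists n; apply/asboolP.
case: (ex_minnP exb) => n /asboolP Sn min_n.
suff exm : exists n, S n /\ forall n', S n' -> (n <= n')%N by exact: xgetPex exm.
exists n; split => // n' Sn'.
by apply: min_n; apply/asboolP.
Qed.

Section Subgroups.
Variable RR : realType.
Implicit Types (G H : set RR) (al : nat -> RR) (A B : vec) (r : RR).

Definition subgroup G : Prop := G 0 /\ forall r s, G r -> G s -> G (r - s).

Lemma subgroupN G r : subgroup G -> G r -> G (- r).
Proof. by case=> G0 GB Gr; rewrite -[- r]add0r; apply: GB. Qed.

Lemma subgroupD G r s : subgroup G -> G r -> G s -> G (r + s).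
Proof.
by move=> sG Gr Gs; rewrite -[s]opprK; apply: sG.2 => //; apply: subgroupN.
Qed.

Lemma subgroupMn G r n : subgroup G -> G r -> G (r *+ n).
Proof.
move=> sG Gr; elim: n => [|n IH]; first by rewrite mulr0n; apply: sG.1.
by rewrite mulrS; apply: subgroupD.
Qed.

Lemma subgroupMz G r (a : int) : subgroup G -> G r -> G (r *~ a).
Proof.
move=> sG Gr; case: a => n; first exact: subgroupMn.
by rewrite NegzE mulrNz; apply: subgroupN => //; apply: subgroupMn.
Qed.

Lemma subgroup_setD2 G H : subgroup G -> subgroup H -> subgroup (setD2 G H).
Proof.
move=> sG sH; split.
  by exists 0; [exact: sG.1|exists 0; [exact: sH.1|rewrite addr0]].
move=> _ _ [g Gg [h Hh <-]] [g' Gg' [h' Hh' <-]].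
exists (g - g'); first exact: sG.2.
by exists (h - h'); [exact: sH.2 | rewrite addrACA opprD].
Qed.

Lemma subgroup_gspan al n : subgroup (gspan al n).
Proof.
split; first by exists (fun=> 0); rewrite big1.
move=> _ _ [a ->] [b ->]; exists (fun i => a i - b i).
by rewrite -sumrB; apply: eq_bigr => i _; rewrite mulrzBr.
Qed.

Lemma gspan0 al r : gspan al 0 r -> r = 0.
Proof. by case=> a ->; rewrite big_ord0. Qed.

Lemma gspanS al n r : gspan al n.+1 r ->
  exists a : int, gspan al n (r - al n *~ a).
Proof.
case=> a ->; exists (a ord_max); rewrite big_ord_recr /= addrK.
by exists (fun i => a (widen_ord (leqnSn n) i)).
Qed.

Lemma gspan_gen al n i : (i < n)%N -> gspan al n (al i).
Proof.
move=> lt_in; exists (fun i' => (i' == Ordinal lt_in)%:Z).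
rewrite (bigD1 (Ordinal lt_in)) //= eqxx big1 ?addr0 // => i' /negPf.
by move=> ->.
Qed.

Lemma gspan_wt al n A : in_dim n A -> gspan al n (wt al A).
Proof. by move=> /(wt_sum al) ->; exists (fun i : 'I_n => (A i)%:Z). Qed.

Lemma gspan_sum al n r G : subgroup G -> (forall i, (i < n)%N -> G (al i)) ->
  gspan al n r -> G r.
Proof.
move=> sG Gal [a ->].
apply: (big_ind G) => [||i _]; first exact: sG.1.
  by move=> ? ?; apply: subgroupD.
by apply: subgroupMz => //; apply: Gal.
Qed.

Lemma gspanW al m n r : (m <= n)%N -> gspan al m r -> gspan al n r.
Proof.
move=> mn; apply: gspan_sum; first exact: subgroup_gspan.
by move=> i im; apply: gspan_gen; apply: leq_trans mn.
Qed.

(** The remainder of [a] modulo [s] again multiplies [r] into [G] and is smaller than [s], so it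
    vanishes. *)
Lemma least_multiple_dvd G r (s : nat) (a : int) : subgroup G -> (0 < s)%N ->
  G (r *+ s) -> (forall n, (0 < n)%N -> G (r *+ n) -> (s <= n)%N) ->
  G (r *~ a) -> exists b : int, a = b * s%:Z.
Proof.
move=> sG s0 Gs mins Ga; exists (a %/ s)%Z.
have := divz_eq a s; set q := (a %/ s)%Z => aE.
have : G (r *~ (a %% s)%Z).
  have -> : (a %% s)%Z = a - q * s%:Z by rewrite {2}aE addrC addKr.
  rewrite mulrzBr; apply: sG.2 => //; rewrite mulrC mulrzA.
  exact: subgroupMz.
have := @ltz_pmod a s s0; have := @modz_ge0 a s.
move: aE; case: (a %% s)%Z => [[|n] aE _ lt_ns Gn|n aE ge0 _ _].
- by rewrite aE addr0.
- by have := mins n.+1 isT Gn; rewrite leqNgt; move: lt_ns; rewrite ltz_nat => ->.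
- have s_neq0 : s%:Z != 0 by rewrite -lt0n.
  by have := ge0 s_neq0.
Qed.

Lemma dotn_wt al n A : in_dim n A -> dotn al n A = wt al A.
Proof. by move=> h; rewrite (wt_sum al h). Qed.

Lemma dotn_gspan al n A : gspan al n (dotn al n A).
Proof. by exists (fun i : 'I_n => (A i)%:Z). Qed.

Lemma sspan_gspan al n r : sspan al n r -> gspan al n r.
Proof. by case=> a ->; exists (fun i : 'I_n => (a i)%:Z). Qed.

Lemma dotnS al n A : dotn al n.+1 A = dotn al n A + al n *+ A n.
Proof. by rewrite /dotn big_ord_recr. Qed.

Lemma dotn_scat m n al ga A C :
  dotn (scat m al ga) (m + n) (vcat m A C) = dotn al m A + dotn ga n C.
Proof.
rewrite /dotn big_split_ord /=; congr (_ + _); apply: eq_bigr => i _.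
  by rewrite vcatE /scat ltn_ord.
by rewrite vcatE /scat ltnNge leq_addr /= addKn.
Qed.

Lemma pushes_commensurable al n A : pushes al n A ->
  commensurable (al n) (gspan al n).
Proof.
case=> A0 hA; exists (A n) => //.
have -> : al n *+ A n = dotn al n.+1 A - dotn al n A by rewrite dotnS addrC addKr.
by apply: (subgroup_gspan al n).2; [exact: sspan_gspan|exact: dotn_gspan].
Qed.

Lemma vle_trans A B C : vle A B -> vle B C -> vle A C.
Proof. by move=> ab bc i; apply: leq_trans (ab i) (bc i). Qed.

(** Passing to a strictly smaller pushing vector lowers the sum of the entries, so the descent stops
    at a minimal one. *)
Lemma reduced_ex al n A : pushes al n A -> exists2 B, vle B A & reduced al n B.
Proof.
have [d dA] := in_dim_ex A.
have [N] := ubnP (\sum_(i < d) A i)%N; elim: N => // N IH in A dA *.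
move=> AN pA; have [[B ltBA pB]|nB] := pselect (exists2 B, vlt B A & pushes al n B).
  have dB : in_dim d B by move=> i di; have := ltBA.1 i; rewrite dA // leqn0 => /eqP.
  have ltB : (\sum_(i < d) B i < \sum_(i < d) A i)%N.
    rewrite ltn_neqAle leq_sum ?andbT => [|i _]; last exact: ltBA.1.
    apply/eqP => eqAB; apply: ltBA.2; apply/fsfunP => i.
    have [le_di|lt_id] := leqP d i; first by rewrite dA ?dB.
    have /leqif_sum : forall i : 'I_d, true -> (B i <= A i ?= iff (B i == A i))%N.
      by move=> i' _; split => //; apply: ltBA.1.
    by case=> _; rewrite eqAB eqxx => /esym /forallP /(_ (Ordinal lt_id)) /eqP.
  have [C leCB rC] := IH B dB (leq_trans ltB AN) pB.
  by exists C => //; apply: vle_trans leCB ltBA.1.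
exists A; first by move=> i.
split; [exact: pushes_commensurable pA|by []|].
by move=> B ltBA pB; apply: nB; exists B.
Qed.

End Subgroups.

(** * Value groups and uniqueness of irreducible exponents *)

Section ValueGroups.
Variables (RR : realType) (K : fieldType) (R : comNzRingType).
Variables (j : {rmorphism R -> K}) (nu : K -> \bar RR) (P T : nat -> R).
Hypothesis nu0 : nu 0 = +oo%E.
Hypothesis beta0_gt0 : 0 < beta j nu P 0.

Local Notation be := (beta j nu P).
Local Notation ga := (gamma j nu T).
Local Notation definedP := (definedP j nu P).
Local Notation P_comm := (P_commensurable j nu P).
Local Notation T_comm := (T_commensurable j nu P T).
Local Notation q := (qP j nu P).
Local Notation G := (G_all j nu P).
Local Notation sT := (sT j nu P T).
Local Notation mT := (mT j nu P T).
Local Notation calP := (calP j nu P).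
Local Notation calT := (calT j nu P T).
Implicit Types (A B C N : vec).

Definition suppP A : Prop := forall i, A i != 0%N -> definedP i.

Lemma definedPW i i' : (i <= i')%N -> definedP i' -> definedP i.
Proof.
move=> le_ii' h t /andP[t0 ti]; apply: h; rewrite t0 /=.
exact: leq_trans ti le_ii'.
Qed.

Lemma definedPS i : definedP i -> P_comm i -> definedP i.+1.
Proof.
move=> di ci t /andP[t0]; rewrite ltnS leq_eqVlt => /orP[/eqP -> //|ti].
by apply: di; rewrite t0.
Qed.

Lemma qP_spec i : P_comm i ->
  [/\ (0 < q i)%N, gspan be i (be i *+ q i) &
      forall n, (0 < n)%N -> gspan be i (be i *+ n) -> (q i <= n)%N].
Proof.
case=> s s0 hs; rewrite /q.
have [|[q0 qG] qmin] := @leastP [set n | (0 < n)%N /\ gspan be i (be i *+ n)].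
  by exists s.
by split => // n n0 nG; apply: qmin.
Qed.

Lemma subgroup_G : subgroup G.
Proof.
split.
  exists 0%N => // [t|]; first by rewrite ltn0 andbF.
  exact: (subgroup_gspan _ _).1.
move=> r s [i di ri] [i' di' si'].
wlog le_ii' : i i' di di' r s ri si' / (i <= i')%N => [H|].
  have [/H|/ltnW /H] := leqP i i'; first exact.
  move=> /(_ di' di s r si' ri) h; rewrite -opprB.
  by case: h => n dn h; exists n => //; apply: subgroupN => //; apply: subgroup_gspan.
exists i' => //; apply: (subgroup_gspan _ _).2 => //.
by apply: gspanW ri; rewrite ltnS.
Qed.

Lemma G_gspan n r : definedP n.-1 -> gspan be n r -> G r.
Proof.
case: n => [_ /gspan0 ->|n /= dn h]; first exact: subgroup_G.1.
by exists n.
Qed.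

Lemma G_wt A : suppP A -> G (wt be A).
Proof.
move=> sA; have [n nA] := in_dim_ex A; rewrite (wt_sum _ nA).
apply: (big_ind G) => [||i _]; first exact: subgroup_G.1.
  by move=> ? ?; apply: subgroupD subgroup_G.
have [->|Ai] := eqVneq (A i) 0%N; first by rewrite mulr0n; apply: subgroup_G.1.
apply: subgroupMn subgroup_G _; exists i; first exact: sA.
exact: gspan_gen.
Qed.

Lemma gamma_eq0 i : T i = 0 -> ga i = 0.
Proof. by move=> Ti; rewrite /gamma Ti rmorph0 nu0. Qed.

Lemma sT_spec i : T_comm i ->
  [/\ (0 < sT i)%N, setD2 G (gspan ga i) (ga i *+ sT i) &
      forall n, (0 < n)%N -> setD2 G (gspan ga i) (ga i *+ n) -> (sT i <= n)%N].
Proof.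
case=> _ [s s0 hs]; rewrite /sT.
have [|[q0 qG] qmin] :=
    @leastP [set n | (0 < n)%N /\ setD2 G (gspan ga i) (ga i *+ n)].
  by exists s.
by split => // n n0 nG; apply: qmin.
Qed.

Lemma mT_spec i : T_comm i ->
  definedP (mT i).-1 ->
  [/\ (mT i <= mT i.+1)%N, definedP (mT i.+1).-1 &
      setD2 (gspan be (mT i.+1)) (gspan ga i) (ga i *+ sT i)].
Proof.
move=> ci di; rewrite /= asboolT //; set S := [set n | _].
have [|[n0 nd nG] _] := @leastP S.
  have [_ [g [n dn gn] gh] _] := sT_spec ci.
  by exists n.+1; split => //; exists g.
split; first exact: leq_maxl.
  by rewrite /maxn; case: ifP.
case: nG => g gn gh; exists g => //; apply: gspanW gn; exact: leq_maxr.
Qed.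

Lemma mT_defined i : definedP (mT i).-1.
Proof.
elim: i => [|i IH]; first by move=> t; rewrite /= ltn0 andbF.
have [ci|nci] := pselect (T_comm i); first by case: (mT_spec ci IH).
by rewrite /= asboolF.
Qed.

Lemma mT_le i : (mT i <= mT i.+1)%N.
Proof.
have [ci|nci] := pselect (T_comm i); first by case: (mT_spec ci (@mT_defined i)).
by rewrite /= asboolF.
Qed.

Lemma T_comm_multiple i (a : int) : T i <> 0 -> a != 0 ->
  setD2 G (gspan ga i) (ga i *~ a) -> T_comm i.
Proof.
move=> Ti a0 h; split => //; exists `|a|%N; first by rewrite absz_gt0.
have sH := subgroup_setD2 subgroup_G (subgroup_gspan ga i).
case: a a0 h => n n0 //; rewrite NegzE mulrNz => h.
by rewrite -[_ *+ _]opprK; apply: subgroupN.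
Qed.

(** Every such multiple of [ga i] is a multiple of [ga i *+ sT i], and [mT i.+1] was chosen so that
    this one element needs only the first [mT i.+1] betas. *)
Lemma multT i (a : int) n : (mT i.+1 <= n)%N ->
  setD2 G (gspan ga i) (ga i *~ a) ->
  setD2 (gspan be n) (gspan ga i) (ga i *~ a).
Proof.
move=> le_n h.
have sH := subgroup_setD2 (subgroup_gspan be n) (subgroup_gspan ga i).
have [Ti|Ti] := pselect (T i = 0).
  by rewrite gamma_eq0 // mul0rz; apply: sH.1.
have [->|a0] := eqVneq a 0; first by rewrite mulr0z; apply: sH.1.
have ci := T_comm_multiple Ti a0 h.
have [s0 sG smin] := sT_spec ci.
have [_ _ [g gG gh]] := mT_spec ci (@mT_defined i).
have [b ->] := least_multiple_dvd
  (subgroup_setD2 subgroup_G (subgroup_gspan ga i)) s0 sG smin h.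
rewrite mulrC mulrzA; apply: subgroupMz => //.
by exists g => //; apply: gspanW gG.
Qed.

(* Adjoining the gamma's adds nothing to G_n once n >= m_i, which is why the
   truncation of the exponents of D_i to their first m_i entries is harmless. *)
Lemma G_gspanD i n r : (mT i <= n)%N -> definedP n.-1 -> G r ->
  setD2 (gspan be n) (gspan ga i) r -> gspan be n r.
Proof.
move=> + dn Gr; elim: i => [|i IH] le_n.
  by case=> g gn [h /gspan0 -> <-]; rewrite addr0.
case=> g gn [h hh ghE]; have [a ha] := gspanS hh.
apply: IH => //; first exact: leq_trans (mT_le i) le_n.
have sH := subgroup_setD2 (subgroup_gspan be n) (subgroup_gspan ga i).
have -> : r = (g + (h - ga i *~ a)) + ga i *~ a by rewrite -addrA subrK.
apply: subgroupD => //; first by exists g => //; exists (h - ga i *~ a).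
(* The last multiple [ga i *~ a] equals [r - g], which lies in [G], minus a combination of the
   earlier gammas. *)
apply: multT => //; exists (r - g).
  by apply: subgroup_G.2 => //; apply: G_gspan gn.
exists (- (h - ga i *~ a)).
  by apply: subgroupN => //; apply: subgroup_gspan.
by rewrite -ghE; lra.
Qed.

(** Irreducibility with respect to [calP], written as bounds on single exponents; [irrP_calP] gives
    the equivalence. *)
Definition irrP A : Prop :=
  forall i, (0 < i)%N -> definedP i -> P_comm i -> (A i < q i)%N.

Lemma calP_spec BD : calP BD ->
  exists i, [/\ (0 < i)%N, definedP i, P_comm i & BD = (vsingle (q i) i, vzero)].
Proof.
case=> i' di' [i /andP[i0 lt_i] ->]; exists i; split => //.
  by apply: definedPW di'; apply: ltnW.
by apply: di'; rewrite i0.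
Qed.

Lemma irrP_calP A C : irreducible_wrt calP (A, C) <-> irrP A.
Proof.
split=> [irr i i0 di ci|irr B D leBA _ /calP_spec [i [i0 di ci [BE _]]]].
  rewrite ltnNge; apply/negP => le_q.
  apply: (irr (vsingle (q i) i) vzero) => [t|t|]; rewrite ?vzeroE //.
    by rewrite vsingleE; case: eqP => // ->.
  exists i.+1; first exact: definedPS.
  by exists i => //; rewrite i0 /=.
by have := leBA i; rewrite BE vsingleE eqxx /= leqNgt irr.
Qed.

(** At the last entry [e >= n] where the vectors differ, the difference of the exponents times
    [be e] lies in the span of the earlier betas. So [q e] is at most that difference, which is
    smaller than [q e] by irreducibility. *)
Lemma irrP_agree n A B : suppP A -> suppP B -> irrP A -> irrP B ->
  gspan be n (wt be A - wt be B) -> forall i, (n <= i)%N -> A i = B i.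
Proof.
move=> sA sB iA iB h.
have [a Aa] := in_dim_ex A; have [b Bb] := in_dim_ex B.
pose d := maxn a b.
have Ad : in_dim d A by apply: in_dimW Aa; apply: leq_maxl.
have Bd : in_dim d B by apply: in_dimW Bb; apply: leq_maxr.
(* Descending induction on [e], starting from a dimension [d] beyond which both vectors vanish. *)
suff main e : (n <= e)%N -> forall i, (e <= i)%N -> A i = B i by exact: main.
have [t] := ubnP (d - e)%N; elim: t => // t IH in e * => lt_t le_ne.
have [le_de|lt_ed] := leqP d e.
  by move=> i ei; rewrite Ad ?Bd //; apply: leq_trans ei.
have {IH lt_t} agree : forall i, (e.+1 <= i)%N -> A i = B i.
  by apply: IH; [lia|exact: leqW].
move=> i; rewrite leq_eqVlt => /orP[/eqP <-|]; last exact: agree.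
wlog lt_AB : A B sA sB iA iB h agree {a b Aa Bb d Ad Bd lt_ed} / (A e < B e)%N.
  move=> W; have [lt|lt|//] := ltngtP (A e) (B e); first exact: W.
  have h' : gspan be n (wt be B - wt be A).
    by rewrite -opprB; apply: subgroupN h; apply: subgroup_gspan.
  by apply/esym/W => // i' /agree ->.
have nz : (0 < B e - A e)%N by rewrite subn_gt0.
have Be : B e != 0%N by rewrite -lt0n; apply: leq_ltn_trans lt_AB.
have he : gspan be e (be e *+ (B e - A e)).
  have -> : be e *+ (B e - A e) =
      (wt be (mkvec e A) - wt be (mkvec e B)) - (wt be A - wt be B).
    by rewrite (wt_agree be agree) !wt_mkvecS mulrnBr ?(ltnW lt_AB) //; lra.
  have sG := subgroup_gspan be e.
  apply: sG.2; last exact: gspanW le_ne h.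
  by apply: sG.2; apply: gspan_wt; apply: in_dim_mkvec.
(* Entry 0 has no bound [q]; there the preceding span is zero and positivity of [be 0] gives the
   contradiction. *)
have [e0|e0] := posnP e.
  move: he; rewrite [X in gspan _ X]e0 => /gspan0 /eqP.
  rewrite mulrn_eq0 => /orP[/eqP z|/eqP be0]; first by rewrite z in nz.
  by have := beta0_gt0; rewrite -[X in be X]e0 be0 ltxx.
have ce : P_comm e by exists (B e - A e)%N.
have [q0 _ qmin] := qP_spec ce.
have := qmin _ nz he; rewrite leqNgt => /negP[].
by apply: leq_ltn_trans (iB e e0 (sB e Be) ce); apply: leq_subr.
Qed.

Lemma calT_in_dim i B D : calT i (B, D) -> in_dim i D.
Proof.
elim: i => [|i IH] /=.
  by move=> /calP_spec[i [_ _ _ [_ ->]]]; apply: in_dim_vzero.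
case=> [/IH|[[_ []]//|[_ [_ ->]]]]; first exact: in_dimW.
move=> t lt_it; rewrite vsingleE; case: eqP lt_it => // ->.
by rewrite ltnn.
Qed.

Lemma calT_calP i : calP `<=` calT i.
Proof. by elim: i => //= i IH BD /IH h; left. Qed.

Lemma irreducible_calTW i A C :
  irreducible_wrt (calT i.+1) (A, C) -> irreducible_wrt (calT i) (A, C).
Proof. by move=> irr B D leB leD h; apply: (irr B D) => //; left. Qed.

Lemma irreducible_calT_irrP i A C : irreducible_wrt (calT i) (A, C) -> irrP A.
Proof.
move=> irr; apply/(irrP_calP A C) => B D leB leD h.
by apply: (irr B D) => //; apply: calT_calP.
Qed.

Lemma irreducible_le S A C A' C' : vle A A' -> vle C C' ->
  irreducible_wrt S (A', C') -> irreducible_wrt S (A, C).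
Proof.
move=> leA leC irr B D /= leB leD; apply: irr => /=.
  exact: vle_trans leA.
exact: vle_trans leC.
Qed.

Lemma weightE A C : weight be ga (A, C) = wt be A + wt ga C.
Proof. by []. Qed.

(* The difference in the last exponents would push gamma_i into the preceding
   span; a reduced vector below it then lies in D_i, against irreducibility. *)
Lemma irreducible_uniq i A C A' C' :
  suppP A -> suppP A' -> in_dim i C -> in_dim i C' ->
  irreducible_wrt (calT i) (A, C) -> irreducible_wrt (calT i) (A', C') ->
  weight be ga (A, C) = weight be ga (A', C') -> (A, C) = (A', C').
Proof.
elim: i => [|i IH] in A C A' C' *.
  move=> sA sA' dC dC' irr irr'; rewrite !weightE.
  have C0 X : in_dim 0 X -> X = vzero.
    by move=> d; apply/fsfunP => i; rewrite vzeroE d.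
  rewrite (C0 C) // (C0 C') // wt_vzero !addr0 => eqw; congr (_, _).
  apply/fsfunP => t; apply: (@irrP_agree 0 A A') => //.
  - exact: irreducible_calT_irrP irr.
  - exact: irreducible_calT_irrP irr'.
  - by rewrite eqw subrr; exact: (subgroup_gspan _ _).1.
wlog le_C : A C A' C' / (C' i <= C i)%N.
  move=> W; have [|/ltnW] := leqP (C' i) (C i); first exact: W.
  by move=> le sA sA' dC dC' irr irr' eqw; apply/esym; apply: W.
move=> sA sA' dC dC' irr irr'; rewrite !weightE.
have wC X : in_dim i.+1 X -> wt ga X = wt ga (mkvec i X) + ga i *+ X i.
  by move=> dX; rewrite -wt_mkvecS mkvec_id.
rewrite (wC C) // (wC C') //; set c := (C i - C' i)%N => eqw.
have CE : ga i *+ C i = ga i *+ c + ga i *+ C' i by rewrite -mulrnDr subnK.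
have {}eqw : wt be A + wt ga (mkvec i C) + ga i *+ c =
             wt be A' + wt ga (mkvec i C').
  by move: eqw; rewrite CE => eqw; lra.
have le_trunc (X : vec) n : vle (mkvec n X) X by move=> t; rewrite mkvecE; case: ifP.
have [c0|c_gt0] := posnP c.
  have eqC : C i = C' i by apply/eqP; rewrite eqn_leq le_C andbT -subn_eq0 -/c c0.
  have : (A, mkvec i C) = (A', mkvec i C').
    apply: IH => //; try exact: in_dim_mkvec.
    - by apply: irreducible_le (irreducible_calTW irr).
    - by apply: irreducible_le (irreducible_calTW irr').
    - by rewrite !weightE -eqw c0 mulr0n addr0.
  case=> -> eqm; congr (_, _).
  by rewrite (vec_split dC) (vec_split dC') eqm eqC.
exfalso.
have C_gt0 : (0 < C i)%N by apply: leq_trans c_gt0 (leq_subr _ _).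
have Ti : T i <> 0.
  move=> Ti; apply: (irr vzero (vsingle 1 i)) => [t|t|].
  - by rewrite vzeroE.
  - by rewrite vsingleE; case: eqP => // ->.
  - by right; right.
have hc : setD2 G (gspan ga i) (ga i *+ c).
  exists (wt be A' - wt be A).
    by apply: subgroup_G.2; apply: G_wt.
  exists (wt ga (mkvec i C') - wt ga (mkvec i C)); last by lra.
  by apply: (subgroup_gspan _ _).2; apply/gspan_wt/in_dim_mkvec.
have ci : T_comm i by split => //; exists c.
set n := mT i.+1.
(* The weights of [A] and [A'] differ by an element of [G] that is also a combination of gammas,
   with [ga i *+ c] as last term; [multT] and [G_gspanD] bring it into the span of the first [n]
   betas. *)
have agree : forall t, (n <= t)%N -> A t = A' t.
  apply: irrP_agree => //.
  - exact: irreducible_calT_irrP irr.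
  - exact: irreducible_calT_irrP irr'.
  apply: (@G_gspanD i) => //; first exact: mT_le.
  - exact: mT_defined.
  - by apply: subgroup_G.2; apply: G_wt.
  have sH := subgroup_setD2 (subgroup_gspan be n) (subgroup_gspan ga i).
  have -> : wt be A - wt be A' =
      wt ga (mkvec i C') - wt ga (mkvec i C) - ga i *+ c by lra.
  apply: sH.2; last by apply: (@multT i c).
  exists 0; first exact: (subgroup_gspan _ _).1.
  exists (wt ga (mkvec i C') - wt ga (mkvec i C)); last by rewrite add0r.
  by apply: (subgroup_gspan _ _).2; apply/gspan_wt/in_dim_mkvec.
have eqn := wt_agree be agree.
(* [C] with its last exponent lowered to the difference [c]. With [A] truncated at [n] it has the
   weight of the truncations of [A'] and [C'], which do not involve [T i]; hence it pushes. *)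
pose C1 := fsadd (mkvec i C) (vsingle c i).
have C1i : C1 i = c by rewrite fsaddE mkvecE vsingleE ltnn eqxx.
have C1t t : (t < i)%N -> C1 t = C t.
  by move=> lt; rewrite fsaddE mkvecE vsingleE lt ltn_eqF // addn0.
have C1d : in_dim i.+1 C1.
  move=> t lt; rewrite fsaddE mkvecE vsingleE ltnNge (ltnW lt) /=.
  by rewrite gtn_eqF.
have leC1 : vle C1 C.
  move=> t; case: (ltngtP t i) => [lt|gt|->]; first by rewrite C1t.
    by rewrite C1d.
  by rewrite C1i leq_subr.
have dotnE (al : nat -> RR) (X : vec) d : dotn al d X = wt al (mkvec d X).
  rewrite -(dotn_wt _ (@in_dim_mkvec d X)) /dotn.
  by apply: eq_bigr => t _; rewrite mkvecE ltn_ord.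
have push : pushes (scat n be ga) (n + i) (vcat n A C1).
  split.
    by rewrite vcatE [X in if X then _ else _]ltnNge leq_addr /= addKn C1i.
  rewrite -addnS dotn_scat.
  exists (fun t : 'I_(n + i) => vcat n A' C' t).
  rewrite -[RHS]/(dotn (scat n be ga) (n + i) (vcat n A' C')) dotn_scat !dotnE.
  have -> : mkvec i.+1 C1 = C1 by rewrite mkvec_id.
  by rewrite wtD wt_vsingle; move: eqn eqw; lra.
(* [V] is cut back at position [n] into a pair [(B, D)] below [(A, C)]. This pair inherits
   irreducibility with respect to [calT i], so it belongs to [calD]. *)
have [V leV redV] := reduced_ex push.
pose B := mkvec n V; pose D := mkvec i.+1 (fun t => V (n + t)%N).
have VE : vcat n B D = V.
  apply/fsfunP => t; rewrite vcatE !mkvecE; case: ltnP => // le_nt.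
  rewrite subnKC //; case: ltnP => // le_it.
  have := leV t; rewrite vcatE ltnNge le_nt /= C1d //.
  by rewrite leqn0 => /eqP.
have leB : vle B A.
  move=> t; rewrite mkvecE; case: ltnP => // lt; have := leV t.
  by rewrite vcatE lt.
have leD : vle D C.
  move=> t; rewrite mkvecE; case: ltnP => // lt; have := leV (n + t)%N.
  rewrite vcatE ltnNge leq_addr /= addKn => /leq_trans; apply; exact: leC1.
apply: (irr B D) => //; right; left; split => //; split => /=.
- exact: in_dim_mkvec.
- exact: in_dim_mkvec.
- exact: irreducible_le leB leD (irreducible_calTW irr).
- by rewrite -/n VE.
Qed.

End ValueGroups.
(** * Monomial ideals and normal forms *)

Section IdealGen.
Variable R : comNzRingType.
Implicit Types (G I : set R).

Lemma ideal_ideal_gen G : ideal (ideal_gen G).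
Proof.
split=> [I [[]//]|a b ha hb I hI|r a ha I hI].
  by case: (hI) => -[_ ID _] _; apply: ID; [exact: ha|exact: hb].
by case: (hI) => -[_ _ IM] _; apply: IM; exact: ha.
Qed.

Lemma sub_ideal_gen G : G `<=` ideal_gen G.
Proof. by move=> a Ga I [_]; apply. Qed.

Lemma ideal_gen_min G I : ideal I -> G `<=` I -> ideal_gen G `<=` I.
Proof. by move=> iI GI a; apply. Qed.

Lemma ideal_genS G G' : G `<=` G' -> ideal_gen G `<=` ideal_gen G'.
Proof.
move=> sub; apply: ideal_gen_min; first exact: ideal_ideal_gen.
by move=> a /sub; apply: sub_ideal_gen.
Qed.

End IdealGen.

Section GeneratingSequenceOfJumpingPolynomials.
Variables (RR : realType) (k K : fieldType) (iK : {rmorphism k -> K}).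
Variables (nu : K -> \bar RR) (R : comNzRingType) (iR : {rmorphism k -> R}).
Variables (j : {rmorphism R -> K}) (m : set R) (x y z : R).
Variables (P T : nat -> R) (D : nat -> seq (vec * vec)).
Hypothesis hnu : rank1_valuation iK nu.
Hypothesis hres : residue_field_is_k iK nu.
Hypothesis hkRK : forall c : k, j (iR c) = iK c.
Hypothesis hfrac : is_fraction_field j.
Hypothesis hdom : dominated_by nu j m.
Hypothesis hparam : regular_parameters3 m x y z.
Hypothesis hxy : (nu (j x) <= nu (j y))%E.
Hypothesis hyz : (nu (j y) <= nu (j z))%E.
Hypothesis hjump : jumping_polynomials iK iR j nu P T D x y z.

Local Notation v a := (nu (j a%R)).
Local Notation w a := (fine (nu (j a%R))).
Local Notation be := (beta j nu P).
Local Notation ga := (gamma j nu T).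
Local Notation definedP := (definedP j nu P).
Local Notation P_comm := (P_commensurable j nu P).
Local Notation T_comm := (T_commensurable j nu P T).
Local Notation q := (qP j nu P).
Local Notation mT := (mT j nu P T).
Local Notation calT := (calT j nu P T).
Local Notation suppP := (suppP j nu P).
Local Notation irrP := (irrP j nu P).
Local Notation weight := (weight be ga).
Local Notation exps := (exponents j nu P D).
Implicit Types (a b f g : R) (A B C N L : vec) (u : vec * vec) (c : k) (t : RR).

(** * Arithmetic of the valuation on R *)

Lemma nu0 : nu 0 = +oo%E. Proof. exact: Defs.val0 hnu. Qed.

Lemma vE a : a != 0 -> v a = (w a)%:E.
Proof.
move=> a0; rewrite fineK //; apply: (val_fin hnu).
by apply: contra a0 => /eqP; rewrite -(rmorph0 j) => /hfrac.1 ->.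
Qed.

Lemma v0 : v 0 = +oo%E. Proof. by rewrite rmorph0 nu0. Qed.

Lemma lt_v a t : a != 0 -> (t%:E < v a)%E = (t < w a).
Proof. by move=> /vE ->; rewrite lte_fin. Qed.

Lemma le_v a t : a != 0 -> (t%:E <= v a)%E = (t <= w a).
Proof. by move=> /vE ->; rewrite lee_fin. Qed.

Lemma mul_neq0 a b : a != 0 -> b != 0 -> a * b != 0.
Proof.
have j0 r : (r == 0) = (j r == 0).
  apply/eqP/eqP => [->|]; first by rewrite rmorph0.
  by rewrite -[X in _ = X](rmorph0 j) => /hfrac.1.
by rewrite !j0 rmorphM mulf_eq0 negb_or => -> ->.
Qed.

Lemma wM a b : a != 0 -> b != 0 -> w (a * b) = w a + w b.
Proof.
move=> a0 b0; rewrite rmorphM (Defs.valM hnu).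
by rewrite [v a]vE // [v b]vE // -EFinD.
Qed.

Lemma v_iR c : c != 0 -> v (iR c) = 0%E.
Proof. by move=> c0; rewrite hkRK (val_trivial_on_k hnu). Qed.

Lemma v1 : v 1 = 0%E.
Proof. by rewrite -(rmorph1 iR) v_iR // oner_neq0. Qed.

Lemma v_ge0 a : (0 <= v a)%E. Proof. exact: hdom.1. Qed.

Lemma lt_vD t a b : (t%:E < v a)%E -> (t%:E < v b)%E -> (t%:E < v (a + b))%E.
Proof.
move=> ha hb; rewrite rmorphD; apply: lt_le_trans (Defs.valD hnu _ _).
by rewrite lt_min ha.
Qed.

Lemma le_vD t a b : (t%:E <= v a)%E -> (t%:E <= v b)%E -> (t%:E <= v (a + b))%E.
Proof.
move=> ha hb; rewrite rmorphD; apply: le_trans (Defs.valD hnu _ _).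
by rewrite le_min ha.
Qed.

Lemma lt_vM t s a b : (t%:E <= v a)%E -> (s%:E < v b)%E ->
  ((t + s)%:E < v (a * b))%E.
Proof.
have [->|a0] := eqVneq a 0; first by rewrite mul0r v0 ltry.
have [->|b0] := eqVneq b 0; first by rewrite mulr0 v0 !ltry.
rewrite le_v // !lt_v ?mul_neq0 // wM // => h1 h2; exact: ler_ltD.
Qed.

Lemma le_vM t s a b : (t%:E <= v a)%E -> (s%:E <= v b)%E ->
  ((t + s)%:E <= v (a * b))%E.
Proof.
have [->|a0] := eqVneq a 0; first by rewrite mul0r v0 !leey.
have [->|b0] := eqVneq b 0; first by rewrite mulr0 v0 !leey.
rewrite !le_v ?mul_neq0 // wM // => h1 h2; exact: lerD.
Qed.

Lemma vN a : v (- a) = v a.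
Proof.
have [->|a0] := eqVneq a 0; first by rewrite oppr0.
have n1 : (-1 : R) != 0 by rewrite oppr_eq0 oner_neq0.
rewrite -mulN1r [LHS]vE ?mul_neq0 // wM // [RHS]vE //.
rewrite -(rmorph1 iR) -rmorphN v_iR ?oppr_eq0 ?oner_neq0 //=.
by rewrite add0r.
Qed.

Lemma vD_eq a b : (v a < v b)%E -> v (a + b) = v a.
Proof.
move=> lt_ab; have [E|a0] := eqVneq a 0.
  by move: lt_ab; rewrite E v0 ltNge leey.
apply/eqP; rewrite eq_le; apply/andP; split.
  rewrite leNgt; apply/negP => lt.
  have : (v a < v ((a + b) - b))%E.
    by rewrite {1}vE //; apply: lt_vD; rewrite ?vN -vE.
  by rewrite addrK ltxx.
by rewrite {1}vE //; apply: le_vD; rewrite -vE // ltW.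
Qed.

Lemma ideal_lt_v t : ideal [set f | (t%:E < v f)%E].
Proof.
split => [|a b /=|r a /= ha]; first by rewrite /= v0 ltry.
  exact: lt_vD.
by rewrite -[t]add0r; apply: lt_vM => //; apply: v_ge0.
Qed.

Lemma ideal_le_v t : ideal [set f | (t%:E <= v f)%E].
Proof.
split => [|a b /=|r a /= ha]; first by rewrite /= v0 leey.
  exact: le_vD.
by rewrite -[t]add0r; apply: le_vM => //; apply: v_ge0.
Qed.

(** This is [R = k + m], from the residue field of V being k and from domination. *)
Lemma residue_ex a : exists c, m (a - iR c).
Proof.
have [c [_ hc]] := hres (v_ge0 a).
by exists c; apply/hdom.2; rewrite rmorphB hkRK.
Qed.

Lemma mgen a : a \in [:: x; y; z] -> m a.
Proof. by move=> h; rewrite hparam; apply: sub_ideal_gen. Qed.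

(** If x were 0, its infinite value would force y and z to vanish as well. Then m would be zero,
    every nonzero element of R would have value 0, and [nu] would be trivial on the fraction
    field. *)
Lemma x_neq0 : x != 0.
Proof.
apply/eqP => x0.
have vx : v x = +oo%E by rewrite x0 v0.
have vy : v y = +oo%E by apply/eqP; rewrite -leye_eq -vx.
have vz : v z = +oo%E by apply/eqP; rewrite -leye_eq -vy.
have z0 a : v a = +oo%E -> a = 0.
  by move=> va; apply/eqP; apply: contraT => /vE; rewrite va.
have m0 a : m a -> a = 0.
  rewrite hparam; apply: (@ideal_gen_min _ _ [set 0]).
    by split => [//|? ? -> ->|r ? ->]; rewrite ?addr0 ?mulr0.
  by move=> b /=; rewrite !inE => /or3P[] /eqP ->; apply: z0.
have nuj a : a != 0 -> v a = 0%E.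
  move=> a0; have := v_ge0 a; rewrite le_eqVlt => /orP[/eqP <- //|].
  by move=> /hdom.2 /m0 ae; rewrite ae eqxx in a0.
have [f f0] := val_nontrivial hnu; case/eqP.
have [a [b [b0 fE]]] := hfrac.2 f.
have a0 : a != 0 by apply: contra f0 => /eqP a0; rewrite fE a0 rmorph0 mul0r.
have jb : j b != 0.
  by apply: contra b0 => /eqP; rewrite -(rmorph0 j) => /hfrac.1 ->.
have : v a = (nu f + v b)%E by rewrite -(Defs.valM hnu) fE divfK.
by rewrite !nuj // adde0.
Qed.

Lemma beta0_gt0 : 0 < be 0.
Proof.
rewrite /beta (jp_P0 hjump) -lt_v ?x_neq0 //.
by apply/hdom.2/mgen; rewrite inE eqxx.
Qed.

Lemma res_step a b c : b != 0 -> (0 < nu (j a / j b - iK c))%E ->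
  ((w b)%:E < v (a - iR c * b))%E.
Proof.
move=> b0 h.
have jb : j b != 0.
  by apply: contra b0 => /eqP; rewrite -(rmorph0 j) => /hfrac.1 ->.
have -> : j (a - iR c * b) = (j a / j b - iK c) * j b.
  by rewrite rmorphB rmorphM hkRK mulrBl divfK.
rewrite (Defs.valM hnu) [v b]vE //; move: h.
by case: (nu _) => [r| |] //=; rewrite ?ltry // -EFinD !lte_fin; lra.
Qed.

(** * Monomials and their reduction modulo larger value *)

Definition mon u : R := monomial P u.1 * monomial T u.2.
Definition eadd u u' : vec * vec := (fsadd u.1 u'.1, fsadd u.2 u'.2).

Lemma monD u u' : mon (eadd u u') = mon u * mon u'.
Proof. by rewrite /mon /= !monomialD mulrACA. Qed.

Lemma weightD u u' : weight (eadd u u') = weight u + weight u'.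
Proof.
case: u u' => A C [A' C']; rewrite !weightE /= !wtD; lra.
Qed.

Lemma w_exp a n : a ^+ n != 0 -> w (a ^+ n) = w a *+ n.
Proof.
elim: n => [|n IH]; first by rewrite expr0 mulr0n v1.
rewrite exprS => h.
have a0 : a != 0 by apply: contra h => /eqP ->; rewrite mul0r.
have an : a ^+ n != 0 by apply: contra h => /eqP ->; rewrite mulr0.
by rewrite wM // IH // mulrS.
Qed.

Lemma w_monomial (Q : nat -> R) A : monomial Q A != 0 ->
  w (monomial Q A) = wt (fun i => w (Q i)) A.
Proof.
have [n dA] := in_dim_ex A; rewrite (monomial_prod Q dA) (wt_sum _ dA).
elim: n {dA} => [|n IH]; first by rewrite !big_ord0 v1.
rewrite !big_ord_recr /= => h; rewrite wM ?IH ?w_exp //;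
  by apply: contra h => /eqP ->; rewrite ?mul0r ?mulr0.
Qed.

Lemma v_mon u : mon u != 0 -> v (mon u) = (weight u)%:E.
Proof.
move=> h; have hP : monomial P u.1 != 0.
  by apply: contra h; rewrite /mon => /eqP ->; rewrite mul0r.
have hT : monomial T u.2 != 0.
  by apply: contra h; rewrite /mon => /eqP ->; rewrite mulr0.
by rewrite vE // wM // !w_monomial.
Qed.

(** Only an inequality, since a vanishing monomial has infinite value but finite weight. *)
Lemma le_v_mon u : ((weight u)%:E <= v (mon u))%E.
Proof.
by have [->|/v_mon ->//] := eqVneq (mon u) 0; rewrite v0 leey.
Qed.

Lemma expsE u : exps u <->
  suppP u.1 /\ forall i, u.2 i != 0%N -> definedT D i.
Proof.
by split=> -[hP hT]; split => i; rewrite ?mem_finsupp => h;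
  (apply: hP || apply: hT); rewrite ?mem_finsupp.
Qed.

Lemma exps_eadd u u' : exps u -> exps u' -> exps (eadd u u').
Proof.
move=> /expsE[hP hT] /expsE[hP' hT']; apply/expsE; split => i /=;
  by rewrite fsaddE addn_eq0 negb_and => /orP[]; auto.
Qed.

(** The predicate covers both strict and weak bounds. It is imposed on the value and not on the
    weight, so a vanishing monomial meets every lower bound. *)
Definition mideal (Q : \bar RR -> Prop) : set R :=
  ideal_gen [set f | exists u, [/\ exps u, Q (v f) & f = mon u]].

Lemma ideal_mideal Q : ideal (mideal Q). Proof. exact: ideal_ideal_gen. Qed.

Definition gt t (e : \bar RR) : Prop := (t%:E < e)%E.

Lemma mideal_mulmon t u f : exps u -> mideal (gt t) f ->
  mideal (gt (weight u + t)) (mon u * f).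
Proof.
move=> eu; apply: (@ideal_gen_min _ _
  [set f | mideal (gt (weight u + t)) (mon u * f)]).
  have [I0 ID IM] := ideal_mideal (gt (weight u + t)).
  split => [|a b /= ha hb|r a /= ha]; first by rewrite /= mulr0.
    by rewrite mulrDr; apply: ID.
  by rewrite mulrCA; apply: IM.
move=> g [u' [eu' lt gE]]; rewrite gE in lt *.
apply: sub_ideal_gen; exists (eadd u u').
split; [exact: exps_eadd| |by rewrite monD].
by apply: lt_vM => //; apply: le_v_mon.
Qed.

(** Proportionality over k in the graded piece of the common weight. The constant may be 0, which
    serves the case [T i = 0]. *)
Definition Red u u' : Prop := weight u = weight u' /\
  exists c, mideal (gt (weight u)) (mon u - iR c * mon u').

Lemma Red_refl u : Red u u.
Proof.
split=> //; exists 1; rewrite rmorph1 mul1r subrr.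
by case: (ideal_mideal (gt (weight u))).
Qed.

Lemma Red_trans u2 u1 u3 : Red u1 u2 -> Red u2 u3 -> Red u1 u3.
Proof.
move=> [w12 [c hc]] [w23 [c' hc']]; split; first by rewrite w12.
have [_ ID IM] := ideal_mideal (gt (weight u1)).
exists (c * c'); rewrite -w12 in hc'.
have := ID _ _ hc (IM (iR c) _ hc').
by rewrite mulrBr addrA subrK mulrA -rmorphM.
Qed.

Lemma Red_mul u0 u u' : exps u0 -> Red u u' -> Red (eadd u0 u) (eadd u0 u').
Proof.
move=> eu0 [wE [c hc]]; split; first by rewrite !weightD wE.
exists c; rewrite weightD !monD.
by have := mideal_mulmon eu0 hc; rewrite mulrBr [mon u0 * (iR c * _)]mulrCA.
Qed.

Lemma mideal_mon Q u : exps u -> Q (v (mon u)) -> mideal Q (mon u).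
Proof. by move=> eu Qu; apply: sub_ideal_gen; exists u. Qed.

Lemma suppP_in_dim n L : definedP n.-1 -> in_dim n L -> suppP L.
Proof.
move=> dn dL i Li; have lt_in : (i < n)%N.
  by rewrite ltnNge; apply: contra Li => /dL ->.
by apply: definedPW dn; rewrite -ltnS prednK // (leq_ltn_trans _ lt_in).
Qed.

Lemma suppP_vsingle i n : definedP i -> suppP (vsingle n i).
Proof. by move=> di t; rewrite vsingleE; case: (t =P i) => [->|]. Qed.

Lemma suppP_fsadd A B : suppP A -> suppP B -> suppP (fsadd A B).
Proof.
by move=> hA hB i; rewrite fsaddE addn_eq0 negb_and => /orP[]; auto.
Qed.

Lemma suppP_le A B : vle A B -> suppP B -> suppP A.
Proof.
by move=> le hB i; rewrite -lt0n => Ai; apply: hB; rewrite -lt0n (leq_trans Ai).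
Qed.

Lemma prod_neq0 n (F : 'I_n -> R) : (forall i, F i != 0) -> \prod_i F i != 0.
Proof.
move=> h; apply: (big_ind (fun a : R => a != 0)) => //; first exact: oner_neq0.
exact: mul_neq0.
Qed.

Lemma monomial_neq0 (Q : nat -> R) A : (forall i, A i != 0%N -> Q i != 0) ->
  monomial Q A != 0.
Proof.
move=> h; have [n dA] := in_dim_ex A; rewrite (monomial_prod Q dA).
apply: prod_neq0 => i; have [->|/h] := eqVneq (A i) 0%N.
  by rewrite expr0 oner_neq0.
move=> Qi; elim: (A i) => [|e IH]; first by rewrite expr0 oner_neq0.
by rewrite exprS mul_neq0.
Qed.

(* If P_i = 0 then q_i = 1, so a reduced exponent avoids P_i. *)
Lemma irrP_neq0 A : suppP A -> irrP A -> monomial P A != 0.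
Proof.
move=> sA iA; apply: monomial_neq0 => i Ai; apply/eqP => Pi.
have [i0|i0] := posnP i; first by have := x_neq0; rewrite -(jp_P0 hjump) -i0 Pi eqxx.
have h : gspan be i (be i *+ 1).
  by rewrite /beta Pi v0 /=; apply: (subgroup_gspan _ _).1.
have ci : P_comm i by exists 1%N.
have [_ _ qmin] := qP_spec ci.
have := leq_trans (iA i i0 (sA i Ai) ci) (qmin 1%N isT h).
by rewrite ltnS leqn0 (negPf Ai).
Qed.

(** A vanishing [T t] puts [(vzero, vsingle 1 t)] into [calT], so an irreducible exponent avoids
    it. *)
Lemma irreducible_neq0 i A C : suppP A -> in_dim i C ->
  irreducible_wrt (calT i) (A, C) -> mon (A, C) != 0.
Proof.
move=> sA dC irr; apply: mul_neq0.
  by apply: irrP_neq0 => //; apply: irreducible_calT_irrP irr.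
apply: monomial_neq0 => t Ct; apply/eqP => Tt.
have lt_ti : (t < i)%N by rewrite ltnNge; apply: contra Ct => /dC ->.
apply: (irr vzero (vsingle 1 t)) => [s|s|]; first by rewrite vzeroE.
  by rewrite vsingleE; case: eqP => // ->; rewrite lt0n.
elim: {dC irr} i lt_ti => // i IH; rewrite ltnS leq_eqVlt => /orP[/eqP <-|/IH h].
  by right; right.
by left.
Qed.

Lemma definedT0 : definedT D 0. Proof. by rewrite /definedT /T_offset. Qed.

Lemma T_offsetS i : T_offset D i.+1 = (T_offset D i + size (D i))%N.
Proof. by rewrite /T_offset big_ord_recr /= addnA. Qed.

(** At an undefined index [D] is empty, so [T_offset] does not grow there and the next index is
    undefined too. *)
Lemma definedTW i i' : (i <= i')%N -> definedT D i' -> definedT D i.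
Proof.
elim: i' => [|i' IH]; first by rewrite leqn0 => /eqP ->.
rewrite leq_eqVlt => /orP[/eqP -> //|lt_i] di'; apply: IH => //.
rewrite /definedT ltnNge; apply/negP => le.
have Dn : D i' = [::].
  by apply: (jp_Dnil hjump) => -[]; rewrite /definedT ltnNge le.
by move: di'; rewrite /definedT T_offsetS Dn addn0 ltnNge (leqW le).
Qed.

(** By [i < T_offset D i] the new index is past [i], so its own offset already counts all of
    [D i]. *)
Lemma definedT_new i n : definedT D i -> (n < size (D i))%N ->
  definedT D (T_offset D i + n).
Proof.
move=> di lt_n; rewrite {1}/definedT.
have le (a b : nat) : (a <= b)%N -> (T_offset D a <= T_offset D b)%N.
  move=> /subnK <-; elim: (b - a)%N => // e IH.
  by rewrite addSn T_offsetS (leq_trans IH) ?leq_addr.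
have := le i.+1 (T_offset D i + n)%N; rewrite T_offsetS => h.
apply: leq_trans (h _); first by rewrite ltn_add2l.
by apply: leq_trans (leq_addr _ _).
Qed.

Definition suppT C : Prop := forall i, C i != 0%N -> definedT D i.

Lemma suppT_fsadd A B : suppT A -> suppT B -> suppT (fsadd A B).
Proof.
by move=> hA hB i; rewrite fsaddE addn_eq0 negb_and => /orP[]; auto.
Qed.

Lemma suppT_le A B : vle A B -> suppT B -> suppT A.
Proof.
by move=> le hB i; rewrite -lt0n => Ai; apply: hB; rewrite -lt0n (leq_trans Ai).
Qed.

Lemma suppT_vzero : suppT vzero.
Proof. by move=> i; rewrite vzeroE. Qed.

Lemma suppP_vzero : suppP vzero.
Proof. by move=> i; rewrite vzeroE. Qed.

(** The residue condition makes the value of the remainder exceed the weight of [u]. The remainder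
    is itself a monomial [mon u''], hence one of the generators of the required ideal. *)
Lemma Red_step u u' u'' c : mon u' != 0 -> weight u = weight u' ->
  (0 < nu (j (mon u) / j (mon u') - iK c))%E ->
  mon u'' = mon u - iR c * mon u' -> exps u'' -> Red u u'.
Proof.
move=> u'0 eqw hc u''E eu''; split=> //; exists c; rewrite -u''E.
apply: mideal_mon => //; rewrite /gt u''E.
have := res_step u'0 hc.
by have := v_mon u'0; rewrite vE // => -[->]; rewrite eqw.
Qed.

Lemma Red_P i : (0 < i)%N -> definedP i -> P_comm i ->
  exists L, [/\ in_dim i L, suppP L & Red (vsingle (q i) i, vzero) (L, vzero)].
Proof.
move=> i0 di ci; have [L [lam [dL irr eqw [_ res] Pi]]] := jp_Pstep hjump i0 di ci.
have sL : suppP L by apply: suppP_in_dim dL; apply: definedPW di; apply: leq_pred.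
(* The construction gives irreducibility only with respect to [calPn i]; the bounds from [i] on hold
   because [L] vanishes there. *)
have iL : irrP L.
  move=> t t0 dt ct; have [q0 _ _] := qP_spec ct.
  have [le_it|lt_ti] := leqP i t; first by rewrite dL.
  rewrite ltnNge; apply/negP => le_q.
  apply: (irr (vsingle (q t) t) vzero) => [s|s|] /=; rewrite ?vzeroE //.
    by rewrite vsingleE; case: eqP => // ->.
  by exists t => //; rewrite t0.
exists L; split => //.
apply: (@Red_step _ _ (vsingle 1 i.+1, vzero) lam) => //.
- rewrite /mon /= monomial_vzero mulr1; exact: irrP_neq0.
- by rewrite !weightE wt_vsingle eqw dotn_wt.
- by rewrite /mon /= !monomial_vzero !mulr1 monomial_vsingle.
- by rewrite /mon /= !monomial_vzero !mulr1 !monomial_vsingle expr1.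
- apply/expsE; split; last exact: suppT_vzero.
  by apply: suppP_vsingle; apply: definedPS.
Qed.

Lemma Red_T i B E : definedT D i -> T_comm i -> calD j nu P T i (B, E) ->
  exists L N, [/\ in_dim i N, suppP L, suppT N & Red (B, E) (L, N)].
Proof.
move=> di ci BE; have [_ /(_ (B, E)) [_ /(_ BE) BED] _] := jp_D hjump di ci.
have lt_n : (index (B, E) (D i) < size (D i))%N by rewrite index_mem.
have [L [N [mu []]]] := jp_Tstep hjump di lt_n.
rewrite nth_index // => -[dL dN] irr eqw [_ res] Tn.
have sL : suppP L by apply: suppP_in_dim dL; apply: mT_defined.
have sN : suppT N.
  move=> t Nt; apply: definedTW di; rewrite leqNgt; apply/negP => lt.
  by move: Nt; rewrite dN // ltnW.
exists L, N; split => //.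
(* The position of [(B, E)] in the list [D i] gives the index of the polynomial [T] that is the
   remainder. *)
apply: (@Red_step _ _
  (vzero, vsingle 1 (T_offset D i + index (B, E) (D i))%N) mu) => //.
- exact: irreducible_neq0 irr.
- by rewrite {1}/mon /= monomial_vzero mul1r monomial_vsingle expr1 Tn.
- apply/expsE; split; first exact: suppP_vzero.
  by move=> t; rewrite vsingleE; case: (t =P _) => // -> _; apply: definedT_new.
Qed.

(** Induction on the dimension, then on the last exponent. Replacing [P n ^+ q n] by a monomial in
    the earlier [P] may raise the lower exponents without control, but it lowers the last one; the
    weight stays constant and could not serve as a measure. *)
Lemma Red_normal_P n A : in_dim n A -> suppP A ->
  exists A', [/\ in_dim n A', suppP A', irrP A' & Red (A, vzero) (A', vzero)].
Proof.
elim: n A => [|n IHn] A.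
  move=> dA sA; exists A; split => //; last exact: Red_refl.
  by move=> i _ _ /qP_spec[q0 _ _]; rewrite dA.
have [a] := ubnP (A n); elim: a A => // a IHa A lt_a dA sA.
have le_t : vle (mkvec n A) A by move=> t; rewrite mkvecE; case: ifP.
have [A1 [dA1 sA1 iA1 RA1]] := IHn _ (@in_dim_mkvec n A) (suppP_le le_t sA).
pose A2 := fsadd (vsingle (A n) n) A1.
have sn : suppP (vsingle (A n) n).
  by move=> t; rewrite vsingleE; case: (t =P _) => // -> /sA.
have dn1 : in_dim n.+1 (vsingle (A n) n).
  by move=> t; rewrite vsingleE; case: eqP => // ->; rewrite ltnn.
have dA2 : in_dim n.+1 A2 by apply: in_dim_fsadd => //; apply: in_dimW dA1.
have sA2 : suppP A2 by apply: suppP_fsadd.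
have A2n : A2 n = A n by rewrite fsaddE vsingleE eqxx dA1 // addn0.
have z0 : vzero = fsadd vzero vzero.
  by apply/fsfunP => i; rewrite fsaddE !vzeroE.
have RA2 : Red (A, vzero) (A2, vzero).
  have e1 : exps (vsingle (A n) n, vzero).
    by apply/expsE; split => //; exact: suppT_vzero.
  have := Red_mul e1 RA1; rewrite /eadd /= -z0.
  by rewrite [fsadd _ (mkvec _ _)]fsaddC -vec_split.
have [iA2|] := pselect (irrP A2); first by exists A2.
move=> niA2.
(* Below [n] the bounds come from [A1], above [n] the vector vanishes, so only the bound at [n] can
   fail. *)
have [n0 [dn [cn le_q]]] :
    (0 < n)%N /\ definedP n /\ P_comm n /\ (q n <= A n)%N.
  apply: contrapT => nH; apply: niA2 => i i0 di ci.
  have [lt|gt|E] := ltngtP i n.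
  - by rewrite /A2 fsaddE vsingleE (ltn_eqF lt) add0n; apply: iA1.
  - by rewrite dA2 //; case: (qP_spec ci).
  - move: E i0 di ci => -> n0 dn cn; rewrite A2n ltnNge.
    by apply/negP => le_q; apply: nH.
have [q0 _ _] := qP_spec cn.
have [L [dL sL RL]] := Red_P n0 dn cn.
pose A3 := fssub A2 (vsingle (q n) n).
have le_sq : forall t : nat, (vsingle (q n) n t <= A2 t)%N.
  by move=> t; rewrite vsingleE; case: eqP => // ->; rewrite A2n.
have le3 : vle A3 A2 by move=> t; rewrite fssubE leq_subr.
have sA3 : suppP A3 by apply: suppP_le le3 sA2.
have dA3 : in_dim n.+1 A3.
  by move=> t lt; have := le3 t; rewrite dA2 // leqn0 => /eqP.
have e3 : exps (A3, vzero) by apply/expsE; split => //; exact: suppT_vzero.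
have := Red_mul e3 RL; rewrite /eadd /= -z0 [fsadd A3 (vsingle _ _)]fsaddC.
rewrite fsadd_sub // => R3.
have [|||A' [dA' sA' iA' RA']] := IHa (fsadd A3 L).
- rewrite fsaddE dL // addn0 fssubE vsingleE eqxx A2n.
  by move: lt_a le_q q0; lia.
- by apply: in_dim_fsadd => //; apply: in_dimW dL.
- exact: suppP_fsadd.
by exists A'; split => //; apply: Red_trans RA2 (Red_trans R3 RA').
Qed.
(** The same double induction on the [T]-exponents. A relation also changes the [P]-exponent, so [A]
    stays arbitrary in both inductions and is normalised anew each time. *)
Lemma Red_normal i A C : in_dim i C -> suppP A -> suppT C ->
  exists A' C', [/\ in_dim i C', suppP A', suppT C',
    irreducible_wrt (calT i) (A', C') & Red (A, C) (A', C')].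
Proof.
elim: i A C => [|i IHi] A.
  move=> C dC sA _; have [n dA] := in_dim_ex A.
  have [A' [_ sA' iA' RA']] := Red_normal_P dA sA.
  exists A', vzero; split => //.
  - exact: in_dim_vzero.
  - exact: suppT_vzero.
  - by apply/irrP_calP.
  - suff -> : C = vzero by [].
    by apply/fsfunP => t; rewrite dC ?vzeroE.
move=> C; have [e] := ubnP (C i); elim: e A C => // e IHe A C lt_e dC sA sC.
have le_t : vle (mkvec i C) C by move=> t; rewrite mkvecE; case: ifP.
have [A1 [C1 [dC1 sA1 sC1 irr1 R1]]] :=
  IHi A _ (@in_dim_mkvec i C) sA (suppT_le le_t sC).
have sn : suppT (vsingle (C i) i).
  by move=> t; rewrite vsingleE; case: (t =P _) => // -> /sC.
have dn : in_dim i.+1 (vsingle (C i) i).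
  by move=> t; rewrite vsingleE; case: eqP => // ->; rewrite ltnn.
pose C2 := fsadd (vsingle (C i) i) C1.
have dC2 : in_dim i.+1 C2 by apply: in_dim_fsadd => //; apply: in_dimW dC1.
have sC2 : suppT C2 by apply: suppT_fsadd.
have C2i : C2 i = C i by rewrite fsaddE vsingleE eqxx dC1 // addn0.
have C2t : forall t : nat, (t < i)%N -> C2 t = C1 t.
  by move=> t lt; rewrite fsaddE vsingleE (ltn_eqF lt) add0n.
have add0 : forall X : vec, fsadd vzero X = X.
  by move=> X; apply/fsfunP => t; rewrite fsaddE vzeroE.
have R2 : Red (A, C) (A1, C2).
  have e1 : exps (vzero, vsingle (C i) i).
    by apply/expsE; split => //; exact: suppP_vzero.
  have := Red_mul e1 R1; rewrite /eadd /= !add0.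
  by rewrite [fsadd _ (mkvec _ _)]fsaddC -vec_split.
(* Elements of [calT i] do not involve [T i], so putting its power back preserves irreducibility. *)
have irr2 : irreducible_wrt (calT i) (A1, C2).
  move=> B E leB leE h; have dE := calT_in_dim h.
  apply: (irr1 B E) => // t; have [le|lt] := leqP i t; first by rewrite dE.
  by rewrite -C2t //; apply: leE.
have [irr|nirr] := pselect (irreducible_wrt (calT i.+1) (A1, C2)).
  by exists A1, C2.
have [B [E [/= leB leE new]]] : exists B E,
    [/\ vle B A1, vle E C2 & calT i.+1 (B, E)].
  apply: contrapT => nH; apply: nirr => B E leB leE h.
  by apply: nH; exists B, E.
have dE : in_dim i.+1 E by apply: (@calT_in_dim _ _ _ j nu P T i.+1 B); exact: new.
suff [A3 [C3 [lt3 dC3 sA3 sC3 R3]]] : exists A3 C3,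
    [/\ (C3 i < C i)%N, in_dim i.+1 C3, suppP A3, suppT C3 & Red (A1, C2) (A3, C3)].
  have [A' [C' [dC' sA' sC' irr' R']]] := IHe A3 C3 (leq_trans lt3 lt_e) dC3 sA3 sC3.
  by exists A', C'; split => //; apply: Red_trans R2 (Red_trans R3 R').
case: new => [/irr2 []//|[[ci BE]|[Ti [BE EE]]]]; last first.
  (* Here [T i = 0], so the monomial vanishes and reduces with constant 0. Dropping the power of
     [T i] keeps the weight, because [ga i] is 0. *)
  rewrite {}EE {dE} in leE.
  have Ci : (0 < C i)%N by rewrite -C2i; have := leE i; rewrite vsingleE eqxx.
  have TC : monomial T (vsingle (C i) i) = 0.
    by rewrite monomial_vsingle Ti expr0n -leqn0 leqNgt Ci.
  exists A1, C1; split => //; first by rewrite dC1.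
    exact: in_dimW dC1.
  split; first by rewrite !weightE wtD wt_vsingle (gamma_eq0 j nu0 Ti) mul0rn add0r.
  exists 0; rewrite rmorph0 mul0r subr0 /mon /= monomialD TC mul0r mulr0.
  by case: (ideal_mideal (gt (weight (A1, C2)))).
have [_ _ _ [_ [Ei _] _]] := BE.
(* The positive entry required by pushing is [E i]; as [N] has dimension [i], the exponent of [T i]
   strictly drops. *)
rewrite vcatE [X in if X then _ else _]ltnNge leq_addr /= addKn in Ei.
have Ci : (0 < C i)%N by rewrite -C2i; apply: leq_trans Ei (leE i).
have di : definedT D i by apply: sC; rewrite -lt0n.
have [L [N [dN sL sN RL]]] := Red_T di ci BE.
have le3 : vle (fssub A1 B) A1 by move=> t; rewrite fssubE leq_subr.
have le3' : vle (fssub C2 E) C2 by move=> t; rewrite fssubE leq_subr.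
have e3 : exps (fssub A1 B, fssub C2 E).
  by apply/expsE; split; [apply: suppP_le le3 sA1|apply: suppT_le le3' sC2].
have := Red_mul e3 RL; rewrite /eadd /= fsaddC fsadd_sub //.
rewrite [fsadd _ E]fsaddC fsadd_sub // => R3.
exists (fsadd (fssub A1 B) L), (fsadd (fssub C2 E) N); split => //.
- rewrite fsaddE dN // addn0 fssubE C2i.
  by rewrite ltn_subrL Ei Ci.
- apply: in_dim_fsadd; last exact: in_dimW dN.
  by move=> t lt; have := le3' t; rewrite dC2 // leqn0 => /eqP.
- by apply: suppP_fsadd => //; apply: suppP_le le3 sA1.
- by apply: suppT_fsadd => //; apply: suppT_le le3' sC2.
Qed.
(** Each element added from stage [i] on has a positive exponent at some [T t] with [t >= i], where
    [C] vanishes. *)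
Lemma irreducible_calT_mono i i' A C : (i <= i')%N -> in_dim i C ->
  irreducible_wrt (calT i) (A, C) -> irreducible_wrt (calT i') (A, C).
Proof.
move=> le_ii' dC irr; elim: i' le_ii' => [|i' IH].
  by rewrite leqn0 => /eqP i0; rewrite -[X in calT X]i0.
rewrite leq_eqVlt => /orP[/eqP <-//|le_ii'] B E /= leB leE.
have Ei' : E i' = 0%N by have := leE i'; rewrite dC // leqn0 => /eqP.
case=> [|[[_ [_ _ _ [_ [Ei _] _]]]|[_ [_ EE]]]]; first exact: IH.
  rewrite vcatE [X in if X then _ else _]ltnNge leq_addr /= addKn in Ei.
  by rewrite Ei' in Ei.
by move: Ei'; rewrite EE vsingleE eqxx.
Qed.

(** [u0] is the irreducible form of [u]. The irreducible form of any other exponent of that weight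
    coincides with it, both being compared at a common stage of [calT]. *)
Lemma leading_monomial u : exps u -> exists u0,
  [/\ mon u0 != 0, exps u0, weight u0 = weight u &
      forall u', exps u' -> weight u' = weight u ->
        exists c, mideal (gt (weight u)) (mon u' - iR c * mon u0)].
Proof.
case: u => A C /expsE[/= sA sC]; have [i dC] := in_dim_ex C.
have [A0 [C0 [dC0 sA0 sC0 irr0 [w0 _]]]] := Red_normal dC sA sC.
exists (A0, C0); split => //; [exact: irreducible_neq0 irr0|exact/expsE|].
case=> A' C' /expsE[/= sA' sC'] eqw; have [i' dC'] := in_dim_ex C'.
have [A1 [C1 [dC1 sA1 sC1 irr1 [w1 [c hc]]]]] := Red_normal dC' sA' sC'.
exists c; rewrite -eqw; suff <- : (A1, C1) = (A0, C0) by [].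
apply: (@irreducible_uniq _ _ _ j nu P T nu0 beta0_gt0 (maxn i i')) => //.
- exact: in_dimW (leq_maxr _ _) dC1.
- exact: in_dimW (leq_maxl _ _) dC0.
- exact: irreducible_calT_mono (leq_maxr _ _) dC1 irr1.
- exact: irreducible_calT_mono (leq_maxl _ _) dC0 irr0.
- by rewrite -w1 eqw.
Qed.

(** * The filtration of R by monomial ideals *)

Lemma definedP01 i : (i < 2)%N -> definedP i.
Proof. by case: i => [|[|]] // _ [|[|t]]. Qed.

Lemma xyz_mon a : a \in [:: x; y; z] -> exists2 u, exps u & a = mon u.
Proof.
rewrite !inE => /or3P[] /eqP ->.
- exists (vsingle 1 0, vzero).
    by apply/expsE; split; [exact/suppP_vsingle/definedP01|exact: suppT_vzero].
  by rewrite /mon monomial_vsingle monomial_vzero mulr1 (jp_P0 hjump).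
- exists (vsingle 1 1, vzero).
    by apply/expsE; split; [exact/suppP_vsingle/definedP01|exact: suppT_vzero].
  by rewrite /mon monomial_vsingle monomial_vzero mulr1 (jp_P1 hjump).
- exists (vzero, vsingle 1 0).
    apply/expsE; split; first exact: suppP_vzero.
    by move=> t; rewrite vsingleE; case: (t =P _) => // -> _; apply: definedT0.
  by rewrite /mon monomial_vsingle monomial_vzero mul1r (jp_T0 hjump).
Qed.

Lemma mideal_m a : m a -> mideal (gt 0) a.
Proof.
rewrite {1}hparam; apply: ideal_gen_min; first exact: ideal_mideal.
move=> b /= hb; have [u eu bE] := xyz_mon hb; rewrite bE.
by apply: mideal_mon => //; rewrite -bE; apply/hdom.2/mgen.
Qed.

Lemma mideal_gt_v t f : mideal (gt t) f -> (t%:E < v f)%E.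
Proof.
apply: (ideal_gen_min (ideal_lt_v t)).
by move=> g [u [_ h _]].
Qed.

(* The graded pieces of the filtration by the ideals [mideal (gt t)] are at
   most one-dimensional over k. *)
Lemma mideal_next t r f :
  (forall u, mon u != 0 -> exps u -> t < weight u -> r <= weight u) ->
  mideal (gt t) f -> mideal (gt r) f \/ v f = r%:E.
Proof.
move=> gap hf; have [I0 ID IM] := ideal_mideal (gt r).
have [[u1 [eu1 w1]]|none] :=
    pselect (exists u, exps u /\ weight u = r); last first.
  left; apply: (ideal_gen_min (ideal_mideal (gt r))) hf => g [u [eu h gE]].
  have [->//|g0] := eqVneq g 0; rewrite gE in g0 h *.
  apply: mideal_mon => //; rewrite /gt v_mon // lte_fin lt_neqAle gap //.
    by rewrite andbT; apply/eqP => E; apply: none; exists u.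
  by move: h; rewrite /gt v_mon // lte_fin.
have [u0 [M0 eu0 w0 lead]] := leading_monomial eu1.
rewrite {}w1 in w0 lead.
have [c hc] : exists c, mideal (gt r) (f - iR c * mon u0).
  move: f hf; apply: (@ideal_gen_min _ _
    [set f | exists c, mideal (gt r) (f - iR c * mon u0)]).
    split=> [|a b [c hc] [c' hc']|b a [c hc]] /=.
    - by exists 0; rewrite rmorph0 mul0r subr0.
    - exists (c + c'); rewrite rmorphD mulrDl opprD addrACA; exact: ID.
    (* The coefficient [b] is replaced by its residue [d]. The error [b - d] lies in m, so by
       monomials of positive value, and its product with [mon u0] goes beyond [r]. *)
    - have [d hd] := residue_ex b; exists (d * c).
      have -> : b * a - iR (d * c) * mon u0 =
          b * (a - iR c * mon u0) + iR c * (mon u0 * (b - iR d)).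
        by rewrite rmorphM; ring.
      apply: ID; first exact: IM.
      apply: IM; have := mideal_mulmon eu0 (mideal_m hd).
      by rewrite w0 addr0.
  move=> g [u [eu h gE]] /=.
  have [->|g0] := eqVneq g 0; first by exists 0; rewrite rmorph0 mul0r subr0.
  rewrite gE in g0 h *; have := h; rewrite /gt v_mon // lte_fin => /(gap u g0 eu).
  rewrite le_eqVlt => /orP[/eqP/esym/(lead u eu) //|lt_r].
  exists 0; rewrite rmorph0 mul0r subr0; apply: mideal_mon => //.
  by rewrite /gt v_mon // lte_fin.
have [c0|c0] := eqVneq c 0.
  by left; move: hc; rewrite c0 rmorph0 mul0r subr0.
(* For nonzero [c] the leading term has value exactly [r] and the rest has larger value. *)
right; have vM : v (iR c * mon u0) = r%:E.
  by rewrite rmorphM (Defs.valM hnu) v_iR // v_mon // w0 add0e.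
rewrite -(subrK (iR c * mon u0) f) addrC vD_eq //.
by rewrite vM; apply: mideal_gt_v.
Qed.

(** The list [s] contains all values strictly between [t] and [r]. Its head [a] is the next
    threshold: [f] passes beyond [a], since otherwise its value would be [a < r]. With no value left
    in between, every nonzero generator of value above [t] has value at least [r]. *)
Lemma mideal_descent (s : seq RR) r t f : sorted <%R s ->
  (forall a, a != 0 -> t < w a -> w a < r -> w a \in s) ->
  mideal (gt t) f -> (r%:E <= v f)%E -> mideal (fun e => (r%:E <= e)%E) f.
Proof.
elim: s t => [|a s IH] t srt hs hf vf.
  have [I0 _ _] := ideal_mideal (fun e => (r%:E <= e)%E).
  apply: (ideal_gen_min (ideal_mideal _)) hf => g [u [eu h gE]].
  have [->//|g0] := eqVneq g 0; rewrite gE in g0 h *.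
  apply: mideal_mon => //; rewrite v_mon // lee_fin leNgt; apply/negP => lt.
  suff: weight u \in [::] by [].
  have E : w (mon u) = weight u by rewrite v_mon.
  by rewrite -E; apply: hs; rewrite ?E // -lte_fin -v_mon.
have all_a : forall b : RR, b \in s -> a < b.
  by apply/allP; apply: order_path_min srt; apply: lt_trans.
have srt' : sorted <%R s := path_sorted srt.
(* The list may contain numbers outside the interval from [t] to [r]; these are discarded. *)
have [le_at|lt_ta] := leP a t.
  apply: (IH t) => // b b0 tb br; have := hs b b0 tb br; rewrite inE.
  by case/orP => // /eqP E; move: tb; rewrite E ltNge le_at.
have [lt_ar|le_ra] := ltP a r; last first.
  apply: (IH t) => // b b0 tb br; have := hs b b0 tb br; rewrite inE.
  by case/orP => // /eqP E; move: br; rewrite E ltNge le_ra.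
have gap u : mon u != 0 -> exps u -> t < weight u -> a <= weight u.
  move=> u0 _ tu; rewrite leNgt; apply/negP => ua.
  have E : w (mon u) = weight u by rewrite v_mon.
  have := hs _ u0; rewrite E => /(_ tu (lt_trans ua lt_ar)).
  rewrite inE => /orP[/eqP H|/all_a]; first by rewrite H ltxx in ua.
  by rewrite ltNge ltW.
have [|vfa] := mideal_next gap hf; last first.
  by move: vf; rewrite vfa lee_fin leNgt lt_ar.
move=> hfa; apply: (IH a) => // b b0 ab br.
have := hs b b0 (lt_trans lt_ta ab) br; rewrite inE => /orP[/eqP E|//].
by rewrite E ltxx in ab.
Qed.

(** * Finiteness of the set of values below a bound *)

(** The linear span over k, defined by splitting off the coefficient of the head, as the induction
    on generators in [kspan_values] requires. *)
Fixpoint kspan (e : seq R) f : Prop :=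
  if e is a :: e' then exists c, kspan e' (f - iR c * a) else f = 0.

Lemma kspan_lin e c f g : kspan e f -> kspan e g -> kspan e (iR c * f + g).
Proof.
elim: e f g => [|a e IH] f g /=; first by move=> -> ->; rewrite mulr0 addr0.
move=> [c1 h1] [c2 h2]; exists (c * c1 + c2).
have -> : iR c * f + g - iR (c * c1 + c2) * a =
    iR c * (f - iR c1 * a) + (g - iR c2 * a).
  by rewrite rmorphD rmorphM; ring.
exact: IH.
Qed.

Lemma kspan_cat e e' f g : kspan e f -> kspan e' g -> kspan (e ++ e') (f + g).
Proof.
elim: e f => [|a e IH] f /=; first by move=> ->; rewrite add0r.
by move=> [c hc] hg; exists c; rewrite addrAC; apply: IH.
Qed.

Lemma kspan_map b e f : kspan e f -> kspan [seq b * a | a <- e] (b * f).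
Proof.
elim: e f => [|a e IH] f /=; first by move=> ->; rewrite mulr0.
by move=> [c hc]; exists c; rewrite mulrCA -mulrBr; apply: IH.
Qed.

(* Two elements of the span with distinct values outside those of the span of
   the tail have a combination in the latter with the smaller value. *)
Lemma kspan_values e :
  exists s : seq RR, forall f, kspan e f -> f != 0 -> w f \in s.
Proof.
elim: e => [|a e [s hs]]; first by exists [::] => f /= ->; rewrite eqxx.
have [[f0 [[c0 h0] nz0 new0]]|none] := pselect (exists f,
    [/\ kspan (a :: e) f, f != 0 & w f \notin s]); last first.
  exists s => f hf f0; apply: contrapT => /negP new.
  by apply: none; exists f.
exists (w f0 :: s) => f [c hc] nz; rewrite inE; apply/orP.
have [|new] := boolP (w f \in s); [by right|left].
have unit_c c' g : g != 0 -> w g \notin s -> kspan e (g - iR c' * a) -> c' != 0.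
  move=> g0 gs hg; apply/eqP => c'0; move: hg.
  by rewrite c'0 rmorph0 mul0r subr0 => /hs /(_ g0); apply/negP.
have c_neq0 := unit_c _ _ nz new hc; have c0_neq0 := unit_c _ _ nz0 new0 h0.
(* Cross-multiplication by the two head coefficients cancels [a]. The inner term
   [kspan_lin (-1) h0 h0] only supplies the zero vector. *)
have hh : kspan e (iR c0 * f + iR (- c) * f0).
  have := kspan_lin c0 hc (kspan_lin (- c) h0 (kspan_lin (-1) h0 h0)).
  congr (kspan e _); rewrite !rmorphN rmorph1; ring.
have v_scale d g : d != 0 -> g != 0 -> v (iR d * g) = (w g)%:E.
  by move=> d0 g0; rewrite rmorphM (Defs.valM hnu) v_iR // add0e vE.
have vf := v_scale _ _ c0_neq0 nz.
have nc : - c != 0 by rewrite oppr_eq0.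
have vf0 := v_scale _ _ nc nz0.
have absurd g (b : RR) : kspan e g -> v g = b%:E -> b \notin s -> False.
  move=> hg vg /negP; apply; have g0 : g != 0.
    by apply/eqP => g0; move: vg; rewrite g0 v0.
  by have := hs g hg g0; rewrite vg.
case: (ltgtP (w f) (w f0)) => // lt; exfalso.
  by apply: absurd hh _ new; rewrite vD_eq vf // vf0 lte_fin.
by apply: absurd hh _ new0; rewrite addrC vD_eq vf0 // vf lte_fin.
Qed.

Lemma m_comb a : m a ->
  exists a1 a2 a3, a = x * a1 + (y * a2 + z * a3).
Proof.
rewrite {1}hparam; apply: (@ideal_gen_min _ _
  [set a | exists a1 a2 a3, a = x * a1 + (y * a2 + z * a3)]).
  split=> [|_ _ [a1 [a2 [a3 ->]]] [b1 [b2 [b3 ->]]]|r _ [a1 [a2 [a3 ->]]]] /=.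
  - by exists 0, 0, 0; ring.
  - by exists (a1 + b1), (a2 + b2), (a3 + b3); ring.
  - by exists (r * a1), (r * a2), (r * a3); ring.
move=> b /=; rewrite !inE => /or3P[] /eqP ->.
- by exists 1, 0, 0; ring.
- by exists 0, 1, 0; ring.
- by exists 0, 0, 1; ring.
Qed.

(** Iterates [R = k + (x, y, z)]. Each round multiplies the error by a parameter of value at least
    [be 0], because x has the least value of the three. *)
Lemma approx n : exists e, forall f, exists g, kspan e g /\
  ((be 0 *+ n)%:E <= v (f - g))%E.
Proof.
have vx : ((be 0)%:E <= v x)%E by rewrite /beta (jp_P0 hjump) -vE ?x_neq0.
have vy := le_trans vx hxy; have vz := le_trans vy hyz.
elim: n => [|n [e he]].
  by exists [::] => f; exists 0; rewrite mulr0n subr0; split => //; apply: v_ge0.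
exists (1 :: [seq x * a | a <- e] ++ [seq y * a | a <- e] ++ [seq z * a | a <- e]).
move=> f; have [c hc] := residue_ex f.
have [a1 [a2 [a3 fE]]] := m_comb hc.
have [g1 [k1 v1']] := he a1; have [g2 [k2 v2']] := he a2.
have [g3 [k3 v3']] := he a3.
exists (iR c + (x * g1 + (y * g2 + z * g3))); split.
  exists c; rewrite mulr1 addrC addKr.
  by apply: kspan_cat; [|apply: kspan_cat]; apply: kspan_map.
have -> : f - (iR c + (x * g1 + (y * g2 + z * g3))) =
    x * (a1 - g1) + (y * (a2 - g2) + z * (a3 - g3)).
  by rewrite -(subrK (iR c) f) fE; ring.
by rewrite mulrS; apply: le_vD; [|apply: le_vD]; apply: le_vM.
Qed.

(** By the Archimedean property some [be 0 *+ n] reaches [r]. An element of value below [r] then has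
    the same value as its approximation in a finite-dimensional span, and such a span has finitely
    many values. *)
Lemma finite_values r :
  exists2 s : seq RR, sorted <%R s & forall a, a != 0 -> w a < r -> w a \in s.
Proof.
have [n le_rn] : exists n, r <= be 0 *+ n.
  exists (Num.bound (r / be 0)); rewrite -mulr_natl -ler_pdivrMr ?beta0_gt0 //.
  have [r0|r0] := leP 0 (r / be 0); first exact/ltW/archi_boundP.
  by rewrite (le_trans (ltW r0)) // ler0n.
have [e he] := approx n; have [s hs] := kspan_values e.
exists (sort <=%R (undup s)).
  by rewrite sort_lt_sorted undup_uniq.
move=> a a0 ar; rewrite mem_sort mem_undup.
have [g [kg vg]] := he a.
have lt : (v a < v (g - a))%E.
  rewrite -[g - a]opprB vN vE // (lt_le_trans _ vg) // lte_fin.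
  exact: lt_le_trans le_rn.
have ag : v g = v a by rewrite -(subrK a g) addrC vD_eq.
have g0 : g != 0 by apply/eqP => g0; move: ag; rewrite g0 v0 vE.
by rewrite -ag; apply: hs.
Qed.

Lemma valuation_ideal_sub r f : (r%:E <= v f)%E ->
  mideal (fun e => (r%:E <= e)%E) f.
Proof.
move=> vf; have [s srt hs] := finite_values r.
apply: (@mideal_descent s r (-1)) => //; first by move=> a a0 _; apply: hs.
(* The empty monomial 1 has value 0, above the threshold, so this ideal is all of R. *)
have [_ _ IM] := ideal_mideal (gt (-1)); rewrite -[f]mulr1; apply: IM.
have E : 1 = mon (vzero, vzero) by rewrite /mon !monomial_vzero mulr1.
rewrite [X in mideal _ X]E; apply: mideal_mon; last first.
  by rewrite -E v1 /gt lte_fin oppr_lt0.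
by apply/expsE; split; [exact: suppP_vzero|exact: suppT_vzero].
Qed.

(** Passing from generators bounded by value to generators bounded by weight loses only vanishing
    monomials; conversely the value is at least the weight. *)
Lemma valuation_idealE r : valuation_ideal nu j r = monomial_ideal j nu P T D r.
Proof.
rewrite eqEsubset; split.
  move=> f /valuation_ideal_sub; apply: ideal_gen_min.
    exact: ideal_ideal_gen.
  move=> g [u [eu h gE]]; have [I0 _ _] := ideal_ideal_gen
    [set f | exists AC : vec * vec, [/\ exps AC, r <= weight AC & f = mon AC]].
  have [->//|g0] := eqVneq g 0; apply: sub_ideal_gen; exists u; split => //.
  by rewrite gE in g0 h; move: h; rewrite v_mon // lee_fin.
apply: ideal_gen_min; first exact: ideal_le_v.
move=> g [u [eu h ->]]; apply: le_trans (le_v_mon u).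
by rewrite lee_fin.
Qed.

(** * The generating sequence as one family *)

Local Notation family := (jumping_family P T).
Local Notation index := (jumping_index j nu P D).
Local Notation fsprod B := (\prod_(i <- finsupp B) family i ^+ B i).
Implicit Types (X Y : {fsfun nat + nat -> nat with 0%N}).

(** Closure under products shows that each [mon u] is of this form without constructing the exponent
    over [nat + nat] that joins [u.1] and [u.2]. *)
Definition family_monomial f : Prop := exists X,
  (forall i, i \in finsupp X -> index i) /\ f = fsprod X.

Lemma family_monomial1 : family_monomial 1.
Proof. by exists [fsfun]; rewrite finsupp0 big_seq_fset0. Qed.

Lemma family_monomialM f g :
  family_monomial f -> family_monomial g -> family_monomial (f * g).
Proof.
move=> [X [hX ->]] [Y [hY ->]]; exists (fsadd X Y); split.
  move=> i; rewrite mem_finsupp fsaddE addn_eq0 negb_and.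
  by case/orP => h; [apply: hX|apply: hY]; rewrite mem_finsupp.
symmetry; apply: (@big_fsadd _ _ _ _ X Y (fun i n => family i ^+ n)) => //.
by move=> i n n'; rewrite exprD.
Qed.

Lemma family_monomial_gen i : index i -> family_monomial (family i).
Proof.
move=> hi; exists [fsfun [fsfun] with i |-> 1%N]; split.
  by move=> i'; rewrite finsupp_with /= finsupp0 !inE orbF => /eqP ->.
rewrite finsupp_with /= finsupp0 fsetU0 big_seq_fset1.
by rewrite fsfun_with expr1.
Qed.

Lemma family_monomial_mon u : exps u -> family_monomial (mon u).
Proof.
move=> [hP hT]; apply: family_monomialM.
  rewrite /monomial big_seq; apply: (big_ind family_monomial) => [||i hi].
  - exact: family_monomial1.
  - exact: family_monomialM.
  elim: (u.1 i) => [|n IH]; first exact: family_monomial1.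
  rewrite exprS; apply: family_monomialM => //.
  exact: (@family_monomial_gen (inl i) (hP i hi)).
rewrite /monomial big_seq; apply: (big_ind family_monomial) => [||i hi].
- exact: family_monomial1.
- exact: family_monomialM.
elim: (u.2 i) => [|n IH]; first exact: family_monomial1.
rewrite exprS; apply: family_monomialM => //.
exact: (@family_monomial_gen (inr i) (hT i hi)).
Qed.

Lemma generating_jumping : generating_sequence j nu index family.
Proof.
move=> r _; rewrite eqEsubset; split.
  move=> f /valuation_ideal_sub; apply: ideal_genS => g [u [eu h gE]].
  have [X [hX XE]] := family_monomial_mon eu.
  by exists X; split; rewrite ?gE -?XE // -gE.
apply: ideal_gen_min; first exact: ideal_le_v.
by move=> g [X [_ _ h]].
Qed.

End GeneratingSequenceOfJumpingPolynomials.

Theorem theorem5p3 (RR : realType) (k K : fieldType) (iK : {rmorphism k -> K})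
  (nu : K -> \bar RR)
  (R : comNzRingType) (iR : {rmorphism k -> R}) (j : {rmorphism R -> K})
  (m : set R) (x y z : R)
  (P T : nat -> R) (D : nat -> seq (vec * vec))
  (hK : function_field iK 3)
  (hnu : rank1_valuation iK nu)
  (hres : residue_field_is_k iK nu)
  (hkRK : forall c : k, j (iR c) = iK c)
  (hfrac : is_fraction_field j)
  (hR : regular_local_ring m 3)
  (hdom : dominated_by nu j m)
  (hparam : regular_parameters3 m x y z)
  (hxy : (nu (j x) <= nu (j y))%E)
  (hyz : (nu (j y) <= nu (j z))%E)
  (hjump : jumping_polynomials iK iR j nu P T D x y z) :
  (forall sigma : RR, value_semigroup nu j sigma ->
     valuation_ideal nu j sigma = monomial_ideal j nu P T D sigma) /\
  generating_sequence j nu (jumping_index j nu P D) (jumping_family P T).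
Proof.
split; last first.
  exact: (generating_jumping hnu hres hkRK hfrac hdom hparam hxy hyz hjump).
move=> sigma _.
exact: (valuation_idealE hnu hres hkRK hfrac hdom hparam hxy hyz hjump).
Qed.
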